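(* Let $N\ge 2$ be an integer, let $s\in(\tfrac12,1)$, and let $\mu$ be a Radon measure with compact support in $\mathbb{R}^N$. Then there exists a unique duality solution $u$ (see context; functions are identified when they agree almost everywhere) of the problem $$(-\Delta)^s u=\mu \ \text{ in } \mathbb{R}^N,\qquad u(x)\to 0 \ \text{ as } |x|\to+\infty .$$ Moreover, $u\in W^{1-\frac{2-2s}{q},\,q}_{\mathrm{loc}}(\mathbb{R}^N)$ for any $q<\frac{N+2-2s}{N+1-2s}$ (with $q\ge 1$, as required in the definition of the fractional Sobolev space).
   Context: Measures are real-valued (signed) Radon measures; a compactly supported one is bounded (finite total variation). Fractional Laplacian: up to a constant, $(-\Delta)^s v(x)=\mathrm{P.V.}\int_{\mathbb{R}^N}\frac{v(x)-v(y)}{|x-y|^{N+2s}}\,dy$. Let $C_{N,s}>0$ be the constant depending only on $N$ and $s$ for which, for every Schwartz function $f$, the Riesz potential $w(x)=(-\Delta)^{-s}f(x)=C_{N,s}\int_{\mathbb{R}^N}\frac{f(y)}{|x-y|^{N-2s}}\,dy$ satisfies $(-\Delta)^s w=f$ in $\mathbb{R}^N$. Duality solution: a function $u\in L^1_{\mathrm{loc}}(\mathbb{R}^N)$ is a duality solution of the problem $(-\Delta)^s u=\mu$ in $\mathbb{R}^N$, $u(x)\to0$ as $|x|\to\infty$, if $$\int_{\mathbb{R}^N}u\,g\,dx=\int_{\mathbb{R}^N}w\,d\mu\quad\text{for every } g\in C_0^\infty(\mathbb{R}^N),$$ where $w(x)=C_{N,s}\int_{\mathbb{R}^N}\frac{g(y)}{|x-y|^{N-2s}}\,dy$.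 (The condition at infinity is not imposed separately; it is encoded in this formulation through the choice of $w$.) Here $C_0^\infty(\mathbb{R}^N)$ denotes smooth compactly supported functions. Fractional Sobolev space: for $0<\eta<1$, $1\le p<\infty$ and $\Omega\subset\mathbb{R}^N$ open, $W^{\eta,p}(\Omega)$ is the set of $u\in L^p(\Omega)$ with $\int_\Omega\int_\Omega\frac{|u(x)-u(y)|^p}{|x-y|^{N+\eta p}}\,dx\,dy<\infty$. One says $u\in W^{\eta,p}_{\mathrm{loc}}(\mathbb{R}^N)$ if $u\in W^{\eta,p}(B_R)$ for every ball $B_R\subset\mathbb{R}^N$. *)

(* Defs.v *)
From HB Require Import structures.
From mathcomp Require Import all_boot all_order all_algebra.
From mathcomp Require Import all_classical all_reals all_analysis.
From mathcomp Require Import measurable_realfun.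

Set Implicit Arguments.
Unset Strict Implicit.
Unset Printing Implicit Defensive.

Import Order.TTheory GRing.Theory Num.Theory.
Import numFieldNormedType.Exports.

Local Open Scope classical_set_scope.
Local Open Scope ring_scope.

(* R^n is 'rV[R]_n. The topology of the library comes from the sup norm, which
   induces the usual topology; `|x| on 'rV[R]_n is the sup norm, so Euclidean
   lengths are written with enorm. *)

Section borel.
Context {R : realType} {n : nat}.

HB.instance Definition _ := @isMeasurable.Build (sigma_display (@open 'rV[R]_n))
  'rV[R]_n <<s @open 'rV[R]_n >> (@sigma_algebra0 _ setT (@open 'rV[R]_n))
  (@sigma_algebraC _ (@open 'rV[R]_n))
  (@sigma_algebra_bigcup _ setT (@open 'rV[R]_n)).

Lemma measurable_rV_coord (i : 'I_n) :
  measurable_fun [set: 'rV[R]_n] (fun x : 'rV[R]_n => x 0 i).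
Proof.
apply: (measurability _ (RGenOInfty.measurableE R)) => _ [_ [a ->] <-].
rewrite setTI; apply: sub_sigma_algebra => /=; apply: open_comp.
  by move=> x _; exact: coord_continuous.
by apply: interval_open.
Qed.

Lemma measurable_fun_rV d (T : measurableType d) (f : T -> 'rV[R]_n) :
  (forall i, measurable_fun [set: T] (fun t => f t 0 i)) ->
  measurable_fun [set: T] f.
Proof.
move=> mf; apply: (@measurability _ _ _ _ _ f (@open 'rV[R]_n)) => //.
move=> _ [U oU <-]; rewrite setTI.
pose B (c : 'rV[rat]_n * rat) : set 'rV[R]_n :=
  [set x | forall i, `|ratr (c.1 0 i) - x 0 i| < ratr c.2].
have -> : f @^-1` U = \bigcup_(c in [set c | B c `<=` U]) (f @^-1` B c).
  rewrite -preimage_bigcup; congr (_ @^-1` _); apply/seteqP; split; last first.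
    by move=> x [c /= cU]; exact: cU.
  move=> x Ux; move: (oU) => /(_ _ Ux).
  rewrite -nbhs_ballE => -[e /= e0 eU].
  have /rat_in_itvoo[r] : 0 < e / 2 by rewrite divr_gt0.
  rewrite inE /= => /andP[r0 re].
  have /choice[c xc] : forall i, exists q : rat, `|ratr q - x 0 i| < ratr r.
    move=> i; have /rat_in_itvoo[q] : x 0 i - ratr r < x 0 i + ratr r.
      by rewrite ltrBlDr -addrA ltrDl addr_gt0.
    by rewrite inE /= => h; exists q; rewrite ltr_distl.
  exists (\row_i c i, r) => /=; last by move=> i; rewrite mxE.
  move=> y /= By; apply: eU; split=> // j i; rewrite !ord1 /ball /=.
  have := By i; rewrite mxE => cy.
  rewrite (le_lt_trans (ler_distD (ratr (c i)) _ _))// (splitr e).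
  by rewrite ltrD// (lt_trans _ re)// distrC.
rewrite bigcup_mkcond; apply: countable_bigcupT_measurable => // c.
case: ifP => // _.
have -> : f @^-1` B c =
    \bigcap_(i in [set: 'I_n])
      ((fun t => `|ratr (c.1 0 i) - f t 0 i|) @^-1` `]-oo, ratr c.2[).
  apply/seteqP; split=> t /=.
    by move=> Bt i _; rewrite /= in_itv/=; exact: Bt.
  by move=> h i; have := h i Logic.I; rewrite /= in_itv.
apply: fin_bigcap_measurable => // i _; rewrite -[X in measurable X]setTI.
have mg : measurable_fun setT (fun t => `|ratr (c.1 0 i) - f t 0 i|).
  by apply: measurableT_comp => //; apply: measurable_funB => //; exact: mf.
exact: mg.
Qed.

End borel.

Section lebesgue_step.
Context {R : realType} {n : nat}.
Variable m : {sigma_finite_measure set 'rV[R]_n -> \bar R}.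

Definition rV_cons (p : measurableTypeR R * 'rV[R]_n) : 'rV[R]_n.+1 :=
  \row_i (if unlift ord0 i is Some j then p.2 0 j else p.1 : R).

Definition rV_uncons (x : 'rV[R]_n.+1) : measurableTypeR R * 'rV[R]_n :=
  (x 0 ord0, \row_i x 0 (lift ord0 i)).

Lemma rV_consK : cancel rV_cons rV_uncons.
Proof.
move=> [a v]; rewrite /rV_uncons mxE unlift_none; congr pair.
by apply/rowP => i; rewrite !mxE liftK.
Qed.

Lemma rV_unconsK : cancel rV_uncons rV_cons.
Proof.
move=> x; apply/rowP => i; rewrite mxE.
by case: unliftP => [j|] -> //=; rewrite mxE.
Qed.

Lemma measurable_rV_cons : measurable_fun [set: _] rV_cons.
Proof.
apply: measurable_fun_rV => i; under eq_fun do rewrite mxE.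
case: unliftP => [j _|_]; last exact: measurable_fst.
apply: (@measurableT_comp _ _ _ _ _ _ (fun x : 'rV[R]_n => x 0 j) _ snd) => //.
exact: measurable_rV_coord.
Qed.

Lemma measurable_rV_uncons : measurable_fun [set: _] rV_uncons.
Proof.
apply: measurable_fun_pair => /=; first exact: measurable_rV_coord.
apply: measurable_fun_rV => i; under eq_fun do rewrite mxE.
exact: measurable_rV_coord.
Qed.

Definition lebesgue_rV_step : set 'rV[R]_n.+1 -> \bar R :=
  pushforward (@lebesgue_measure R \x m)%E rV_cons.

Let step0 : lebesgue_rV_step set0 = 0%E.
Proof. by apply: measure0; exact: measurable_rV_cons. Qed.

Let step_ge0 A : (0 <= lebesgue_rV_step A)%E.
Proof. by apply: measure_ge0; exact: measurable_rV_cons. Qed.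

Let step_sigma_additive : semi_sigma_additive lebesgue_rV_step.
Proof. by apply: measure_semi_sigma_additive; exact: measurable_rV_cons. Qed.

HB.instance Definition _ := isMeasure.Build _ _ _ lebesgue_rV_step
  step0 step_ge0 step_sigma_additive.

Let step_sigma_finite : sigma_finite [set: _] lebesgue_rV_step.
Proof.
have /sigma_finiteP[F [FT ndF Foo]] := sigma_finiteT (@lebesgue_measure R).
have /sigma_finiteP[G [GT ndG Goo]] := sigma_finiteT m.
exists (fun k => rV_uncons @^-1` (F k `*` G k)).
  apply/seteqP; split=> // x _.
  have [k _ Fk] : (\bigcup_k F k) (rV_uncons x).1 by rewrite -FT.
  have [l _ Gl] : (\bigcup_k G k) (rV_uncons x).2 by rewrite -GT.
  exists (maxn k l) => //; split.
    by move: Fk; exact/subsetPset/ndF/leq_maxl.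
  by move: Gl; exact/subsetPset/ndG/leq_maxr.
move=> k; have [mF Fk] := Foo k; have [mG Gk] := Goo k; split.
  rewrite -[X in measurable X]setTI; apply: measurable_rV_uncons => //.
  exact: measurableX.
rewrite /lebesgue_rV_step /pushforward -comp_preimage.
rewrite (_ : rV_uncons \o rV_cons = id); last exact/funext/rV_consK.
by rewrite preimage_id product_measure1E// lte_mul_pinfty// ge0_fin_numE.
Qed.

HB.instance Definition _ :=
  @Measure_isSigmaFinite.Build _ _ R lebesgue_rV_step step_sigma_finite.

End lebesgue_step.

Fixpoint lebesgue_rV (R : realType) (n : nat) :
    {sigma_finite_measure set 'rV[R]_n -> \bar R} :=
  if n is n'.+1 then lebesgue_rV_step (lebesgue_rV R n')
  else @dirac _ 'rV[R]_0 0 R.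

Lemma lebesgue_rV_box (R : realType) (n : nat)
    (A : 'I_n -> set (measurableTypeR R)) :
  (forall i, measurable (A i)) ->
  lebesgue_rV R n [set x | forall i, A i (x 0 i)] =
  (\prod_(i < n) lebesgue_measure (A i))%E.
Proof.
elim: n A => [|n IHn] A mA.
  by rewrite big_ord0 /= diracE mem_set// => -[].
rewrite big_ord_recl -IHn// -product_measure1E//; last first.
  set B := (X in measurable X).
  have -> : B = \bigcap_(i in [set: 'I_n])
      ((fun x : 'rV[R]_n => x 0 i) @^-1` A (lift ord0 i)).
    by apply/seteqP; split=> x /= h i; [move=> _|]; exact: h.
  apply: fin_bigcap_measurable => // i _; rewrite -[X in measurable X]setTI.
  exact: (measurable_rV_coord i measurableT (mA _)).
rewrite /= /lebesgue_rV_step /pushforward; congr product_measure1.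
apply/seteqP; split=> -[a v] /= => [h|[Aa Av] i].
  split=> [|i]; first by have := h ord0; rewrite mxE unlift_none.
  by have := h (lift ord0 i); rewrite mxE liftK.
by rewrite mxE; case: unliftP => [j|] ->.
Qed.

Section smooth_functions.
Context {R : realType} {n : nat}.
Implicit Types f : 'rV[R]_n -> R.

Definition enorm (x : 'rV[R]_n) : R := Num.sqrt (\sum_i x 0 i ^+ 2).

Definition partials (l : seq 'I_n) f : 'rV[R]_n -> R :=
  foldr (fun i g x => 'D_(delta_mx 0 i) g x) f l.

Definition smooth f := forall l : seq 'I_n,
  continuous (partials l f) /\
  forall i x, derivable (partials l f) x (delta_mx 0 i).

Definition schwartz f := smooth f /\
  forall (l : seq 'I_n) (k : nat), exists M : R,
    forall x, enorm x ^+ k * `|partials l f x| <= M.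

Definition test_function f := smooth f /\ compact (closure [set x | f x != 0]).

End smooth_functions.

Section riesz_potential.
Context {R : realType} {n : nat}.
Local Notation leb := (lebesgue_rV R n).
Implicit Types (s c C : R) (f v w : 'rV[R]_n -> R).

(* At y = x the integrand is 0, since 0 `^ a = 0 for a != 0 and 0^-1 = 0. *)
Definition riesz_potential s C f (x : 'rV[R]_n) : R :=
  C * \int[leb]_y (f y / enorm (x - y) `^ (n%:R - 2 * s)).

(* (-Delta)^s v (x) = l, with c the normalising constant in front of the
   principal value. *)
Definition is_frac_laplacian s c v (x : 'rV[R]_n) (l : R) :=
  c * \int[leb]_(y in [set y | e < enorm (x - y)])
    ((v x - v y) / enorm (x - y) `^ (n%:R + 2 * s)) @[e --> 0^'+] --> l.

End riesz_potential.

(* The constant usually written C_{n,s}; it depends on the normalising constant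
   c chosen for the fractional Laplacian. *)
Definition riesz_constant (R : realType) (n : nat) (s c C : R) :=
  0 < C /\
  forall f : 'rV[R]_n -> R, schwartz f ->
    forall x, is_frac_laplacian s c (riesz_potential s C f) x (f x).

Section charge_integral.
Context d (T : measurableType d) (R : realType).
Variable mu : {charge set T -> \bar R}.

Lemma hahn_ex : {PN : set T * set T | hahn_decomposition mu PN.1 PN.2}.
Proof.
by apply/cid; have [P [N PN]] := Hahn_decomposition mu; exists (P, N).
Qed.

(* The value does not depend on the Hahn decomposition chosen, as two of them
   differ by sets all of whose measurable subsets are null. *)
Definition charge_integral (f : T -> R) : R :=
  \int[jordan_pos (projT2 hahn_ex)]_x f x -
  \int[jordan_neg (projT2 hahn_ex)]_x f x.

End charge_integral.

Section duality.
Context {R : realType} {n : nat}.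
Local Notation leb := (lebesgue_rV R n).
Implicit Types (mu : {charge set 'rV[R]_n -> \bar R}) (u : 'rV[R]_n -> R).

(* A compactly supported signed Radon measure is bounded, and conversely every
   bounded signed Borel measure on R^n is Radon, so that such measures are the
   (finite) charges vanishing outside some compact set. *)
Definition compactly_supported mu := exists2 K : set 'rV[R]_n, compact K &
  forall A, measurable A -> A `&` K = set0 -> mu A = 0%E.

Definition L1loc u := measurable_fun setT u /\
  forall K : set 'rV[R]_n, compact K ->
    (\int[leb]_(x in K) `|u x|%:E < +oo)%E.

Definition duality_solution s C mu u := L1loc u /\
  forall g : 'rV[R]_n -> R, test_function g ->
    \int[leb]_x (u x * g x) = charge_integral mu (riesz_potential s C g).

Definition frac_sobolev (eta p : R) (O : set 'rV[R]_n) u :=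
  [/\ measurable_fun O u,
      (\int[leb]_(x in O) (`|u x| `^ p)%:E < +oo)%E &
      (\int[leb]_(x in O) \int[leb]_(y in O)
         (`|u x - u y| `^ p / enorm (x - y) `^ (n%:R + eta * p))%:E
       < +oo)%E].

Definition frac_sobolev_loc (eta p : R) u :=
  forall (x0 : 'rV[R]_n) (r : R), 0 < r ->
    frac_sobolev eta p [set x | enorm (x - x0) < r] u.

End duality.

(* Main.v *)
Require Import Defs.
From mathcomp Require Import all_boot all_order all_algebra.
From mathcomp Require Import all_classical all_reals all_analysis.
From mathcomp Require Import measurable_realfun lra ring.
Set Implicit Arguments.
Unset Strict Implicit.
Unset Printing Implicit Defensive.
Import Order.TTheory GRing.Theory Num.Theory.
Import numFieldNormedType.Exports.
Local Open Scope classical_set_scope.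
Local Open Scope ring_scope.

(** The solution is the Riesz potential of mu. Write a = N - 2s, and let V be
    the function x |-> int |x - y|^-a d nu(y), for nu the positive and then the
    negative part of mu; the solution is C times the difference of the two V.

    Everything rests on one estimate ([integral_riesz_kernel_le]): for
    0 < g < N the integral of |x - y|^-g over a set of finite measure is bounded
    uniformly in y. By Tonelli, potentials of finite measures of any such
    order g are integrable on sets of finite measure.

    Duality. For a bounded g supported in a ball, g(x) |x - y|^-a is integrable
    for dx d nu(y), and the duality formula is Fubini's theorem for this function
    ([potential_duality]).

    Uniqueness. The difference h of two solutions is locally integrable and
    orthogonal to all test functions. Cut-offs built from exp(-1/t) are
    test functions increasing to the indicator of any open box, so the integral
    of h over every box vanishes; boxes generate the Borel sets and are stable under
    intersection, so h = 0 almost everywhere ([L1loc_eq0]).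

    Regularity. Interpolating between the trivial bound and the Lipschitz bound
    for the kernel gives, for 0 < theta <= 1,
      | |x|^-a - |z|^-a | <= const |x - z|^theta (|x|^-(a+theta) + |z|^-(a+theta)).
    Taking q-th powers and averaging against nu with Jensen's inequality, the
    Gagliardo integrand of order eta for V is at most a constant times
      (W(x) + W(z)) |x - z|^-(N + eta q - theta q),
    where W is the potential of nu of order (a + theta) q. Its double integral is
    finite as soon as eta < theta and (a + theta) q < N. For
    eta = 1 - (2 - 2s)/q one has
      (a + eta) q = (N + 1 - 2s) q - (2 - 2s),
    which is smaller than N exactly when q < (N + 2 - 2s)/(N + 1 - 2s); so theta
    slightly larger than eta works
    ([frac_sobolev_potential], [frac_sobolev_riesz_solution]). Local integrability
    of the solution is the case q = 1. *)

(** * Inequalities for real powers *)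

Section real_inequalities.
Context {R : realType}.
Implicit Types a b d p q r t theta : R.

Lemma powR_max_le p a b : 0 <= p -> 0 <= a -> 0 <= b ->
  Num.max a b `^ p <= a `^ p + b `^ p.
Proof.
move=> p0 a0 b0; case: (leP a b) => _; rewrite ?lerDl ?lerDr powR_ge0//.
Qed.

Lemma powR_add_le p a b : 0 <= p -> 0 <= a -> 0 <= b ->
  (a + b) `^ p <= 2 `^ p * (a `^ p + b `^ p).
Proof.
move=> p0 a0 b0.
have m0 : 0 <= Num.max a b by rewrite le_max a0.
apply: (@le_trans _ _ ((2 * Num.max a b) `^ p)).
  rewrite ge0_ler_powR ?nnegrE ?addr_ge0 ?mulr_ge0//.
  by rewrite mulr_natl mulr2n lerD// le_max lexx ?orbT.
by rewrite powRM// ler_wpM2l ?powR_ge0// powR_max_le.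
Qed.

(** Compare t with l: below the crossover the first term on the right
    suffices, above it the second one does. Integrated in t, this replaces
    Hoelder's inequality in the proof of Jensen's inequality up to a constant.
    *)
Lemma ler_powR_crossover q t l : 1 <= q -> 0 <= t -> 0 <= l ->
  l `^ (q - 1) * t <= l `^ q + t `^ q.
Proof.
move=> q1 t0 l0; have q0 : 0 < q by exact: lt_le_trans q1.
have [tl|/ltW lt] := leP t l.
  apply: (@le_trans _ _ (l `^ q)); last by rewrite lerDl powR_ge0.
  by rewrite -(mulr_powRB1 l0 q0) mulrC ler_wpM2r ?powR_ge0.
apply: (@le_trans _ _ (t `^ q)); last by rewrite lerDr powR_ge0.
rewrite -(mulr_powRB1 t0 q0) mulrC ler_wpM2l//.
by rewrite ge0_ler_powR ?nnegrE// subr_ge0.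
Qed.

Lemma min1_le_powR theta x : 0 < theta <= 1 -> 0 <= x ->
  Num.min 1 x <= x `^ theta.
Proof.
move=> /andP[th0 th1]; rewrite le_eqVlt => /predU1P[<-|x0].
  by rewrite powR0 ?gt_eqF// ge_min lexx orbT.
rewrite ge_min; have [x1|/ltW x1] := leP x 1.
  by rewrite ger1_powR ?orbT// x0.
by rewrite -[X in X <= _](powRr0 x) ler_powR// ltW.
Qed.

(** Both e^y >= 1 + y and ln y <= y - 1 are tangent-line bounds; the first is
    used at a ln x, the second at 1/x. *)
Lemma onem_powR_le a x : 0 <= a -> 0 < x -> 1 - x `^ a <= a * (x^-1 - 1).
Proof.
move=> a0 x0.
have h1 : 1 + a * ln x <= x `^ a.
  by rewrite /powR gt_eqF// expR_ge1Dx.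
have h2 : ln x^-1 <= x^-1 - 1.
  rewrite -[X in ln X](subrK 1) addrC le_ln1Dx//.
  by rewrite ltrBrDl addrN invr_gt0.
rewrite lnV ?posrE// in h2.
by have := ler_wpM2l a0 h2; lra.
Qed.

(** The relative difference 1 - (r/t)^a is at most 1, and at most a (t - r) /
    r; the power theta interpolates between the two bounds. *)
Lemma powRN_sub_le a theta r t d : 0 <= a -> 0 < theta <= 1 ->
  0 < r -> r <= t -> t - r <= d ->
  0 <= r `^ (- a) - t `^ (- a) <= (1 + a) * d `^ theta * r `^ (- (a + theta)).
Proof.
move=> a0 /andP[th0 th1] r0 rt trd.
have t0 : 0 < t by exact: lt_le_trans rt.
have d0 : 0 <= d by rewrite (le_trans _ trd)// subr_ge0.
set x := r / t; have x0 : 0 < x by rewrite divr_gt0.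
have x1 : x <= 1 by rewrite ler_pdivrMr// mul1r.
have -> : r `^ (- a) - t `^ (- a) = r `^ (- a) * (1 - x `^ a).
  have -> : t `^ (- a) = r `^ (- a) * x `^ a; last by rewrite mulrBr mulr1.
  rewrite powRM ?invr_ge0 ?ltW// -powR_inv1 ?ltW// -powRrM mulN1r.
  by rewrite (powRN r) mulKf// gt_eqF ?powR_gt0.
have xa1 : x `^ a <= 1.
  by rewrite -(powRr0 x) ger_powR// x0.
rewrite mulr_ge0 ?powR_ge0 ?subr_ge0//=.
rewrite opprD powRD ?(gt_eqF r0) ?implybT// mulrCA ler_wpM2l ?powR_ge0//.
rewrite -mulrA (_ : d `^ theta * _ = (d / r) `^ theta); last first.
  by rewrite powRM ?invr_ge0 ?(ltW r0)// -(powR_inv1 (ltW r0)) -powRrM mulN1r.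
have dr0 : 0 <= d / r by rewrite divr_ge0// ltW.
apply: (@le_trans _ _ ((1 + a) * Num.min 1 (d / r))); last first.
  by rewrite ler_wpM2l ?addr_ge0// min1_le_powR// th0.
have [_|_] := leP 1 (d / r).
  by have := powR_ge0 x a; lra.
apply: (le_trans (onem_powR_le a0 x0)).
rewrite invf_div ler_pM//; first by rewrite subr_ge0 ler_pdivlMr// mul1r.
- lra.
- by rewrite ler_pdivlMr// mulrBl divfK ?gt_eqF// mul1r.
Qed.

(** The convention 0 `^ (- a) = 0 is compatible with this bound: when r = 0
    the left side is t^(- a q), and t <= d. *)
Lemma powRN_diff_powR_le a theta q r t d : 0 < a -> 0 < theta <= 1 -> 0 < q ->
  0 <= r -> 0 <= t -> `|r - t| <= d ->
  `|r `^ (- a) - t `^ (- a)| `^ q <=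
  (1 + a) `^ q * d `^ (theta * q) *
  (r `^ (- ((a + theta) * q)) + t `^ (- ((a + theta) * q))).
Proof.
move=> a0 th q0; have /andP[th0 th1] := th.
have at0 : 0 < a + theta by rewrite addr_gt0.
have aN0 : - a != 0 by rewrite oppr_eq0 gt_eqF.
wlog rt : r t / r <= t => [hwlog|] r0 t0 rtd.
  have [rt|/ltW tr] := leP r t; first exact: hwlog.
  by rewrite distrC (addrC (r `^ _)) hwlog// distrC.
rewrite distrC ger0_norm ?subr_ge0// in rtd.
have d0 : 0 <= d by rewrite (le_trans _ rtd)// subr_ge0.
have K0 : 0 <= (1 + a) * d `^ theta by rewrite mulr_ge0 ?powR_ge0//; lra.
(* One of the two powers on the right already suffices. *)
suff h : exists2 z, z \in [:: r; t] &
    `|r `^ (- a) - t `^ (- a)| <= (1 + a) * d `^ theta * z `^ (- (a + theta)).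
  have [z zrt hz] := h.
  have {}hz := ge0_ler_powR (ltW q0) (normr_ge0 _ : _ \in Num.nneg)
    (mulr_ge0 K0 (powR_ge0 _ _) : _ \in Num.nneg) hz.
  apply: (le_trans hz).
  rewrite powRM ?powR_ge0// powRM ?powR_ge0//; last lra.
  rewrite -!powRrM mulNr ler_wpM2l ?mulr_ge0 ?powR_ge0//.
  move: zrt; rewrite !inE => /orP[]/eqP->; rewrite ?lerDl ?lerDr powR_ge0//.
move: r0; rewrite le_eqVlt => /predU1P[r0|r0].
  rewrite -r0 subr0 in rtd.
  exists t; rewrite ?inE ?eqxx ?orbT// -r0 powR0// sub0r normrN.
  rewrite ger0_norm ?powR_ge0//.
  move: t0; rewrite le_eqVlt => /predU1P[<-|t0].
    by rewrite !powR0 ?oppr_eq0 ?gt_eqF// mulr0.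
  rewrite (_ : - a = theta - (a + theta)); last by ring.
  rewrite powRD ?(gt_eqF t0) ?implybT// ler_wpM2r ?powR_ge0//.
  rewrite -[X in X <= _]mul1r ler_pM ?powR_ge0//; first lra.
  by rewrite ge0_ler_powR ?nnegrE ?(ltW t0) ?(ltW th0).
exists r; rewrite ?inE ?eqxx//.
have /andP[h0 h1] := powRN_sub_le (ltW a0) th r0 rt rtd.
by rewrite ger0_norm.
Qed.

End real_inequalities.

(** * Euclidean norm, cubes and balls *)

Section euclidean_norm.
Context {R : realType} {n : nat}.
Implicit Types (x y z : 'rV[R]_n) (r : R).

Lemma sqr_enorm x : enorm x ^+ 2 = \sum_i x 0 i ^+ 2.
Proof. by rewrite sqr_sqrtr// sumr_ge0// => i _; exact: sqr_ge0. Qed.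

Lemma enorm_ge0 x : 0 <= enorm x.
Proof. exact: sqrtr_ge0. Qed.

Lemma enorm0 : enorm (0 : 'rV[R]_n) = 0.
Proof. by rewrite /enorm big1 ?sqrtr0// => i _; rewrite mxE expr0n. Qed.

Lemma enormN x : enorm (- x) = enorm x.
Proof.
by congr Num.sqrt; apply: eq_bigr => i _; rewrite mxE sqrrN.
Qed.

Lemma enorm_distC x y : enorm (x - y) = enorm (y - x).
Proof. by rewrite -enormN opprB. Qed.

Lemma normr_coord_le_enorm x i : `|x 0 i| <= enorm x.
Proof.
rewrite -sqrtr_sqr ler_wsqrtr// (bigD1 i)//= lerDl sumr_ge0// => j _.
exact: sqr_ge0.
Qed.

Lemma enorm_eq0 x : enorm x = 0 -> x = 0.
Proof.
move=> x0; apply/rowP => i; rewrite mxE; apply/eqP.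
by rewrite -normr_le0 -x0 normr_coord_le_enorm.
Qed.

(** Cauchy-Schwarz, by expanding the square of |y| x - |x| y. *)
Lemma dot_le_enorm x y : \sum_i x 0 i * y 0 i <= enorm x * enorm y.
Proof.
have [/enorm_eq0->|x0] := eqVneq (enorm x) 0.
  by rewrite enorm0 mul0r big1// => i _; rewrite mxE mul0r.
have [/enorm_eq0->|y0] := eqVneq (enorm y) 0.
  by rewrite enorm0 mulr0 big1// => i _; rewrite mxE mulr0.
have xy0 : 0 < enorm x * enorm y.
  by rewrite mulr_gt0// lt_neqAle enorm_ge0 eq_sym andbT.
have : 0 <= \sum_i (enorm y * x 0 i - enorm x * y 0 i) ^+ 2.
  by rewrite sumr_ge0// => i _; exact: sqr_ge0.
have -> : \sum_i (enorm y * x 0 i - enorm x * y 0 i) ^+ 2 =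
    2 * (enorm x * enorm y) * (enorm x * enorm y - \sum_i x 0 i * y 0 i).
  under eq_bigr do rewrite sqrrB !exprMn.
  rewrite big_split/= big_split/= sumrN -!mulr_sumr -!sqr_enorm.
  rewrite (_ : \sum_i enorm y * x 0 i * (enorm x * y 0 i) *+ 2 =
    2 * (enorm x * enorm y) * \sum_i x 0 i * y 0 i); first by ring.
  by rewrite mulr_sumr; apply: eq_bigr => i _; ring.
by rewrite pmulr_rge0 ?subr_ge0// mulr_gt0.
Qed.

Lemma ler_enormD x y : enorm (x + y) <= enorm x + enorm y.
Proof.
rewrite -(@ler_pXn2r _ 2) ?nnegrE ?addr_ge0 ?enorm_ge0//.
rewrite sqrrD !sqr_enorm.
under eq_bigr do rewrite mxE sqrrD.
rewrite !big_split/= lerD2r lerD2l -mulr2n lerMn2r/=.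
exact: dot_le_enorm.
Qed.

Lemma ler_enorm_dist x y z : `|enorm (x - y) - enorm (z - y)| <= enorm (x - z).
Proof.
have h u v : enorm (u - y) - enorm (v - y) <= enorm (u - v).
  by rewrite lerBlDr (le_trans _ (ler_enormD _ _))// addrA subrK.
by rewrite ler_norml h lerNl opprB (enorm_distC x z) h.
Qed.

Lemma measurable_enorm d (T : measurableType d) (f : T -> 'rV[R]_n) :
  measurable_fun setT f -> measurable_fun setT (fun t => enorm (f t)).
Proof.
move=> mf; apply: (measurableT_comp (f := @Num.sqrt R)).
  by apply: continuous_measurable_fun; exact: sqrt_continuous.
apply: (@measurable_sum _ _ _ _ _ _ (fun i t => f t 0 i ^+ 2)) => i.
by apply: measurable_funX; apply: (measurableT_comp (measurable_rV_coord i)).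
Qed.

Lemma measurable_enorm_sub :
  measurable_fun setT (fun p : 'rV[R]_n * 'rV[R]_n => enorm (p.1 - p.2)).
Proof.
apply: measurable_enorm; apply: measurable_fun_rV => i.
under eq_fun do rewrite !mxE.
apply: measurable_funB.
  exact: (measurableT_comp (measurable_rV_coord i) measurable_fst).
exact: (measurableT_comp (measurable_rV_coord i) measurable_snd).
Qed.

Definition cube x r : set 'rV[R]_n := [set z | forall i, `|z 0 i - x 0 i| < r].

Lemma cubeE x r : cube x r =
  [set z | forall i, `]x 0 i - r, x 0 i + r[%classic (z 0 i)].
Proof.
by apply/seteqP; split=> z /= h i; have := h i; rewrite /= in_itv/= ltr_distl.
Qed.

Lemma measurable_cube x r : measurable (cube x r).
Proof.
have -> : cube x r = \bigcap_(i in [set: 'I_n])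
    ((fun z : 'rV[R]_n => z 0 i) @^-1` `]x 0 i - r, x 0 i + r[).
  by rewrite cubeE; apply/seteqP; split=> z /= h i; [move=> _|]; exact: h.
apply: fin_bigcap_measurable => // i _; rewrite -[X in measurable X]setTI.
exact: measurable_rV_coord.
Qed.

Lemma lebesgue_rV_cube x r : 0 <= r ->
  lebesgue_rV R n (cube x r) = ((2 * r) ^+ n)%:E.
Proof.
move=> r0; rewrite cubeE.
rewrite (lebesgue_rV_box (A := fun i => `]x 0 i - r, x 0 i + r[%classic))//.
rewrite (eq_bigr (fun=> (2 * r)%:E)); last first.
  move=> i _; rewrite lebesgue_measure_itv/= lte_fin.
  case: ltP => [_|h]; first by rewrite -EFinB; congr EFin; ring.
  rewrite lerD2l in h.
  have -> : r = 0 by apply/le_anti/andP; split=> //; lra.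
  by rewrite mulr0.
by rewrite prodEFin prodr_const card_ord.
Qed.

Lemma enorm_cube x y r : enorm (x - y) < r -> cube y r x.
Proof.
move=> xyr i; apply: le_lt_trans xyr.
by have := normr_coord_le_enorm (x - y) i; rewrite !mxE.
Qed.

Lemma measurable_eball x r : measurable [set z : 'rV[R]_n | enorm (z - x) < r].
Proof.
rewrite (_ : mkset _ = (fun z => enorm (z - x)) @^-1` `]-oo, r[%classic); last first.
  by apply/seteqP; split=> z /=; rewrite in_itv.
rewrite -[X in measurable X]setTI.
have : measurable_fun setT (fun z : 'rV[R]_n => enorm (z - x)).
  apply: measurable_enorm; apply: measurable_fun_rV => i.
  under eq_fun do rewrite !mxE.
  by apply: measurable_funB => //; exact: measurable_rV_coord.
exact.
Qed.

Lemma lebesgue_eball_lty x r :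
  (lebesgue_rV R n [set z : 'rV[R]_n | (enorm (z - x) < r)%R] < +oo)%E.
Proof.
have [r0|r0] := leP 0 r; last first.
  rewrite (_ : mkset _ = set0) ?measure0//.
  apply/seteqP; split=> // z /= /lt_trans/(_ r0).
  by rewrite ltNge enorm_ge0.
apply: (@le_lt_trans _ _ (lebesgue_rV R n (cube x r))).
  rewrite le_measure ?inE//; [exact: measurable_eball|exact: measurable_cube|].
  by move=> z; exact: enorm_cube.
by rewrite lebesgue_rV_cube// ltry.
Qed.

End euclidean_norm.

(** * Local integrability of Riesz kernels *)

Section riesz_kernel.
Context {R : realType} {n : nat}.
Local Notation leb := (lebesgue_rV R n).
Implicit Types (x y z : 'rV[R]_n) (g r : R).

Definition riesz_kernel g x y : R := enorm (x - y) `^ (- g).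

Lemma riesz_kernel_ge0 g x y : 0 <= riesz_kernel g x y.
Proof. exact: powR_ge0. Qed.

Lemma riesz_kernelC g x y : riesz_kernel g x y = riesz_kernel g y x.
Proof. by rewrite /riesz_kernel enorm_distC. Qed.

Lemma measurable_riesz_kernel g :
  measurable_fun setT (fun p : 'rV[R]_n * 'rV[R]_n => riesz_kernel g p.1 p.2).
Proof.
apply: (measurableT_comp (measurable_powR (- g))).
exact: measurable_enorm_sub.
Qed.

Lemma measurable_riesz_kernel1 g y :
  measurable_fun setT (fun x => riesz_kernel g x y).
Proof.
exact: (measurableT_comp (measurable_riesz_kernel g) (pair2_measurable y)).
Qed.

Lemma exists_dyadic_scale r : 0 < r < 1 ->
  exists k : nat, 2^-1 ^+ k.+1 <= r < 2^-1 ^+ k.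
Proof.
move=> /andP[r0 r1].
have ex : exists k : nat, 2^-1 ^+ k.+1 <= r.
  have /cvgr0Pnorm_lt/(_ _ r0) : (2^-1 : R) ^+ k @[k --> \oo] --> 0.
    by apply: cvg_expr; rewrite ger0_norm ?invf_lt1// ltr1n.
  move=> [k _ /(_ k.+1 (leqnSn k))]; rewrite ger0_norm ?exprn_ge0//.
  by move=> /ltW ?; exists k.
exists (ex_minn ex); case: ex_minnP => k hk kmin; rewrite hk/=.
case: k hk kmin => [|k] hk kmin; first by rewrite expr0.
rewrite ltNge; apply/negP => /kmin; by rewrite ltnn.
Qed.

Let w g : R := 2 `^ g.

(** If 2^-(k+1) <= |x - y| < 2^-k, the kernel is at most 2^((k+1) g) and x
    lies in the cube of half-side 2^-k around y. Hence only volumes of cubes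
    enter the estimates below. *)
Lemma riesz_kernel_dyadic_le g x y : 0 < g ->
  ((riesz_kernel g x y)%:E <= 1 + \sum_(k <oo)
     (w g ^+ k.+1)%:E * (\1_(cube y (2^-1 ^+ k)) x)%:E)%E.
Proof.
move=> g0; have w0 k : 0 <= w g ^+ k by rewrite exprn_ge0// powR_ge0.
have t0 k : (0 <= (w g ^+ k.+1)%:E * (\1_(cube y (2^-1 ^+ k)) x)%:E)%E.
  by rewrite mule_ge0// lee_fin.
have [r1|r1] := leP 1 (enorm (x - y)).
  rewrite (@le_trans _ _ 1%E)//.
    rewrite lee_fin /riesz_kernel -[leRHS](powRr0 (enorm (x - y))).
    by rewrite ler_powR// oppr_le0 ltW.
  by rewrite leeDl// nneseries_ge0.
have := enorm_ge0 (x - y); rewrite le_eqVlt => /predU1P[r0|r0].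
  rewrite /riesz_kernel -r0 powR0 ?oppr_eq0 ?gt_eqF//.
  by rewrite adde_ge0// nneseries_ge0.
have /exists_dyadic_scale[k /andP[kr rk]] : 0 < enorm (x - y) < 1 by rewrite r0.
rewrite (@le_trans _ _ (\sum_(0 <= k < k.+1)
     (w g ^+ k.+1)%:E * (\1_(cube y (2^-1 ^+ k)) x)%:E)%E)//; last first.
  apply: (@le_trans _ _ (\sum_(k <oo)
     (w g ^+ k.+1)%:E * (\1_(cube y (2^-1 ^+ k)) x)%:E)%E).
    exact: nneseries_lim_ge.
  by rewrite leeDr.
rewrite big_nat_recr//= (@le_trans _ _ ((w g ^+ k.+1)%:E *
    (\1_(cube y (2^-1 ^+ k)) x)%:E)%E)//; last first.
  by rewrite leeDr// sume_ge0.
rewrite indicE mem_set ?mule1; last exact: enorm_cube.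
rewrite lee_fin /riesz_kernel powRN.
apply: (@le_trans _ _ ((2^-1 ^+ k.+1) `^ g)^-1).
  rewrite lef_pV2 ?posrE ?powR_gt0 ?exprn_gt0//.
  by rewrite ge0_ler_powR ?nnegrE ?(ltW g0) ?exprn_ge0 ?(ltW r0).
rewrite -[2^-1 ^+ k.+1]powR_mulrn// -powRrM mulrC powRrM powR_mulrn ?powR_ge0//.
by rewrite -exprVn -powRN -powR_inv1// -powRrM mulN1r opprK.
Qed.

(** Integrating the dyadic bound term by term gives a geometric series of
    ratio 2^g / 2^n < 1 whose terms do not depend on y. *)
Lemma integral_riesz_kernel_le g (D : set 'rV[R]_n) : 0 < g < n%:R ->
  measurable D -> (leb D < +oo)%E ->
  exists2 M : R, 0 <= M &
    forall y, (\int[leb]_(x in D) (riesz_kernel g x y)%:E <= M%:E)%E.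
Proof.
move=> /andP[g0 gn] mD Doo.
pose z : R := w g / 2 ^+ n.
have z0 : 0 <= z by rewrite divr_ge0 ?powR_ge0.
have z1 : z < 1.
  rewrite ltr_pdivrMr ?exprn_gt0// mul1r -powR_mulrn// /w /powR.
  by rewrite gt_eqF// ltr_expR ltr_pM2r// ln_gt0 ?ltr1n.
pose S := (\sum_(k <oo) (w g * 2 ^+ n * z ^+ k)%:E : \bar R)%E.
have Sfin : S \is a fin_num.
  have -> : S = (w g * 2 ^+ n * (1 - z)^-1)%:E.
    apply/cvg_lim => //; apply: cvg_EFin.
      by apply: nearW => k; rewrite sumEFin.
    have := @cvg_geometric_series R (w g * 2 ^+ n) z.
    rewrite ger0_norm// => /(_ z1); apply: cvg_trans.
    apply: near_eq_cvg; apply: nearW => k.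
    by rewrite /series/= sumEFin.
  by [].
exists (fine (leb D) + fine S).
  rewrite addr_ge0// fine_ge0//.
  rewrite nneseries_ge0// => k _ _.
  by rewrite lee_fin !mulr_ge0 ?exprn_ge0 ?powR_ge0.
move=> y; rewrite EFinD !fineK// ?ge0_fin_numE//.
have mk (E : set 'rV[R]_n) : measurable_fun E (fun x => (riesz_kernel g x y)%:E).
  apply/measurable_EFinP; apply: measurable_funTS.
  exact: measurable_riesz_kernel1.
have mt k : measurable_fun setT (fun x : 'rV[R]_n =>
    ((w g ^+ k.+1)%:E * (\1_(cube y (2^-1 ^+ k)) x)%:E)%E).
  apply/measurable_EFinP => /=; apply: measurable_funM => //.
  by apply: measurable_indic; exact: measurable_cube.
have w0 k : 0 <= w g ^+ k by rewrite exprn_ge0// powR_ge0.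
have t0 k x : (0 <= (w g ^+ k.+1)%:E * (\1_(cube y (2^-1 ^+ k)) x)%:E)%E.
  by rewrite mule_ge0// lee_fin.
have mS (E : set 'rV[R]_n) : measurable_fun E (fun x : 'rV[R]_n => (\sum_(k <oo)
     (w g ^+ k.+1)%:E * (\1_(cube y (2^-1 ^+ k)) x)%:E)%E).
  apply: measurable_funTS; apply: ge0_emeasurable_sum => //.
apply: (@le_trans _ _ (\int[leb]_(x in D) (1 + \sum_(k <oo)
     (w g ^+ k.+1)%:E * (\1_(cube y (2^-1 ^+ k)) x)%:E))%E).
  apply: ge0_le_integral => //.
  - by move=> x _; rewrite lee_fin riesz_kernel_ge0.
  - by apply: emeasurable_funD.
  - by move=> x _; exact: riesz_kernel_dyadic_le.
rewrite ge0_integralD//; last by move=> x _; rewrite nneseries_ge0.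
rewrite integral_cst// mul1e leeD2l//.
apply: (@le_trans _ _ (\int[leb]_x (\sum_(k <oo)
     (w g ^+ k.+1)%:E * (\1_(cube y (2^-1 ^+ k)) x)%:E))%E).
  apply: ge0_subset_integral => //.
  by move=> x _; rewrite nneseries_ge0.
rewrite integral_nneseries//.
apply: lee_nneseries => [k _ _|k _].
  by apply: integral_ge0 => x _.
rewrite ge0_integralZl//; first last.
- by rewrite lee_fin.
- by apply/measurable_EFinP; apply: measurable_indic; exact: measurable_cube.
rewrite integral_indic//; last exact: measurable_cube.
rewrite setIT [X in (_ * X)%E](lebesgue_rV_cube y) ?exprn_ge0// -EFinM lee_fin.
have E : (2^-1 ^+ k) ^+ n = (2 ^+ n)^-1 ^+ k :> R.
  by rewrite -exprM mulnC exprM exprVn.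
by rewrite exprMn E /z exprMn exprS le_eqVlt; apply/orP; left; apply/eqP; ring.
Qed.

End riesz_kernel.

(** * Integral inequalities and iterated integrals over sets *)

Section integral_inequalities.
Context d (T : measurableType d) {R : realType}.
Variable m : {measure set T -> \bar R}.

(** If exactly one of F and G is infinite then so is H; if both are, fine
    sends them both to 0. *)
Lemma dist_fine_le (F G H : \bar R) : (0 <= F)%E -> (0 <= G)%E -> (0 <= H)%E ->
  (F <= G + H)%E -> (G <= F + H)%E -> (`|fine F - fine G|%:E <= H)%E.
Proof.
case: F => [F| |]//; case: G => [G| |]//; case: H => [H| |]//=.
- rewrite -!EFinD !lee_fin => _ _ _ h1 h2; rewrite ler_norml; lra.
- by move=> *; rewrite leey.
- by move=> *; rewrite leey.
- by move=> *; rewrite leey.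
- by move=> *; rewrite subrr normr0.
- by move=> *; rewrite leey.
Qed.

Lemma fine_le_ge0 (F : \bar R) : (0 <= F)%E -> ((fine F)%:E <= F)%E.
Proof. by case: F => [F| |]//= _; rewrite leey. Qed.

(** Thanks to fine mapping infinity to 0, this holds also where the integrals
    of f and g are infinite, which later avoids discarding a null set of
    points. *)
Lemma dist_fine_integral_le (f g : T -> R) :
  measurable_fun setT f -> measurable_fun setT g ->
  (forall x, 0 <= f x) -> (forall x, 0 <= g x) ->
  (`|fine (\int[m]_x (f x)%:E) - fine (\int[m]_x (g x)%:E)|%:E <=
   \int[m]_x `|f x - g x|%:E)%E.
Proof.
move=> mf mg f0 g0.
have mfg : measurable_fun setT (fun x => `|f x - g x|).
  by apply: measurableT_comp => //; exact: measurable_funB.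
apply: dist_fine_le; try by apply: integral_ge0 => x _; rewrite lee_fin.
- rewrite -ge0_integralD//; try (by move=> x _; rewrite lee_fin);
    try exact/measurable_EFinP.
  apply: ge0_le_integral => //; try (by move=> x _; rewrite ?lee_fin//);
    try exact/measurable_EFinP.
  + by apply: emeasurable_funD; exact/measurable_EFinP.
  + move=> x _; rewrite -EFinD lee_fin.
    by rewrite addrC -lerBlDr (le_trans (ler_norm _)).
- rewrite -ge0_integralD//; try (by move=> x _; rewrite lee_fin);
    try exact/measurable_EFinP.
  apply: ge0_le_integral => //; try (by move=> x _; rewrite ?lee_fin//);
    try exact/measurable_EFinP.
  + by apply: emeasurable_funD; exact/measurable_EFinP.
  + move=> x _; rewrite -EFinD lee_fin.
    by rewrite addrC -lerBlDr distrC (le_trans (ler_norm _)).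
Qed.

(** Jensen's inequality for a measure of mass at most M, up to the constant.
    For l = c / (2 M), [ler_powR_crossover] integrates to 2 M l^q <= M l^q +
    int h^q. *)
Lemma powR_integral_le (c M q : R) (h : T -> R) : 1 <= q -> 0 < M ->
  (m setT <= M%:E)%E -> measurable_fun setT h -> (forall x, 0 <= h x) ->
  0 <= c -> (c%:E <= \int[m]_x (h x)%:E)%E ->
  ((c `^ q)%:E <= (M^-1 * (2 * M) `^ q)%:E * \int[m]_x (h x `^ q)%:E)%E.
Proof.
move=> q1 M0 mM mh h0 c0 ch.
have q0 : 0 < q by exact: lt_le_trans q1.
pose l := c / (2 * M).
have M20 : 0 < 2 * M by rewrite mulr_gt0.
have l0 : 0 <= l by rewrite divr_ge0// ltW.
have mhq : measurable_fun setT (fun x => h x `^ q).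
  exact: (measurableT_comp (measurable_powR q)).
set I := (\int[m]_x (h x `^ q)%:E)%E.
have I0 : (0 <= I)%E by apply: integral_ge0 => x _; rewrite lee_fin powR_ge0.
suff H : ((M * l `^ q)%:E <= I)%E.
  have -> : c `^ q = (M^-1 * (2 * M) `^ q) * (M * l `^ q).
    rewrite mulrACA mulVf ?gt_eqF// mul1r -powRM// ?(ltW M20)//.
    by rewrite /l mulrC divfK ?gt_eqF.
  by rewrite EFinM lee_wpmul2l// lee_fin mulr_ge0 ?powR_ge0// invr_ge0 ltW.
have H1 : ((l `^ (q - 1))%:E * \int[m]_x (h x)%:E <= (l `^ q * M)%:E + I)%E.
  rewrite -ge0_integralZl//; first last.
  - by rewrite lee_fin powR_ge0.
  - by move=> x _; rewrite lee_fin.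
  - exact/measurable_EFinP.
  apply: (@le_trans _ _ (\int[m]_x ((l `^ q)%:E + (h x `^ q)%:E))%E).
    apply: ge0_le_integral => //.
    - by move=> x _; rewrite lee_fin mulr_ge0 ?powR_ge0.
    - by apply/measurable_EFinP; apply: measurable_funM.
    - by apply: emeasurable_funD => //; exact/measurable_EFinP.
    - by move=> x _; rewrite -EFinD lee_fin; exact: ler_powR_crossover.
  rewrite ge0_integralD//; first last.
  - exact/measurable_EFinP.
  - by move=> x _; rewrite lee_fin powR_ge0.
  - by move=> x _; rewrite lee_fin powR_ge0.
  by rewrite integral_cst// EFinM leeD2r// lee_wpmul2l// lee_fin powR_ge0.
have H2 : ((2 * M * l `^ q)%:E <= (l `^ q * M)%:E + I)%E.
  apply: le_trans H1.
  apply: (@le_trans _ _ ((l `^ (q - 1))%:E * c%:E)%E); last first.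
    by rewrite lee_wpmul2l// lee_fin powR_ge0.
  rewrite -EFinM lee_fin -(mulr_powRB1 l0 q0) mulrA.
  by rewrite /l (mulrC (2 * M)) divfK ?gt_eqF// mulrC.
clear H1; move: H2 I0; case: I => [I| |]//; last by move=> *; rewrite leey.
by rewrite -EFinD !lee_fin => H2 _; lra.
Qed.

End integral_inequalities.

Section tonelli_on_sets.
Local Open Scope ereal_scope.
Context d1 d2 (T1 : measurableType d1) (T2 : measurableType d2) {R : realType}.
Variables (m1 : {sigma_finite_measure set T1 -> \bar R})
  (m2 : {sigma_finite_measure set T2 -> \bar R}).
Variables (D1 : set T1) (D2 : set T2).
Hypotheses (mD1 : measurable D1) (mD2 : measurable D2).
Variable f : T1 * T2 -> \bar R.
Hypotheses (mf : measurable_fun setT f) (f0 : forall z, 0 <= f z).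

Let f_ (z : T1 * T2) := f z * (\1_D1 z.1)%:E * (\1_D2 z.2)%:E.

Let mf_ : measurable_fun setT f_.
Proof.
apply: emeasurable_funM.
  apply: emeasurable_funM => //; apply/measurable_EFinP.
  have h1 : measurable_fun setT (\1_D1 : T1 -> R) by exact: measurable_indic.
  exact: (measurableT_comp h1 measurable_fst).
apply/measurable_EFinP.
have h2 : measurable_fun setT (\1_D2 : T2 -> R) by exact: measurable_indic.
exact: (measurableT_comp h2 measurable_snd).
Qed.

Let f_0 z : 0 <= f_ z.
Proof. by rewrite /f_ !mule_ge0// lee_fin. Qed.

Lemma integral_indicE d (T : measurableType d) (m : {measure set T -> \bar R})
    (D : set T) (g : T -> \bar R) :
  \int[m]_(x in D) g x = \int[m]_x (g x * (\1_D x)%:E).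
Proof.
rewrite integral_mkcond; apply: eq_integral => x _; rewrite patchE indicE.
by case: ifPn => _; rewrite ?mule1 ?mule0.
Qed.

Let inner1 x : \int[m2]_y f_ (x, y) = (\int[m2]_(y in D2) f (x, y)) * (\1_D1 x)%:E.
Proof.
rewrite /f_/= indicE; case: (x \in D1).
  by rewrite mule1 [RHS]integral_indicE; apply: eq_integral => y _; rewrite mule1.
by rewrite mule0; apply: integral0_eq => y _; rewrite mule0 mul0e.
Qed.

Let inner2 y : \int[m1]_x f_ (x, y) = (\int[m1]_(x in D1) f (x, y)) * (\1_D2 y)%:E.
Proof.
rewrite /f_/= !(indicE _ D2); case: (y \in D2).
  by rewrite mule1 [RHS]integral_indicE; apply: eq_integral => x _; rewrite mule1.
by rewrite mule0; apply: integral0_eq => x _; rewrite mule0.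
Qed.

(** Tonelli's theorem applied to f times the indicator of D1 x D2. *)
Lemma fubini_tonelli_in :
  \int[m1]_(x in D1) \int[m2]_(y in D2) f (x, y) =
  \int[m2]_(y in D2) \int[m1]_(x in D1) f (x, y).
Proof.
rewrite integral_indicE [RHS]integral_indicE.
under eq_integral do rewrite -inner1.
under [RHS]eq_integral do rewrite -inner2.
exact: fubini_tonelli.
Qed.

Lemma measurable_integral_in :
  measurable_fun D1 (fun x => \int[m2]_(y in D2) f (x, y)).
Proof.
have h := measurable_fun_fubini_tonelli_F (m2 := m2) f_ mf_ f_0.
apply: (eq_measurable_fun (fubini_F m2 f_)).
  by move=> x; rewrite inE => D1x; rewrite /fubini_F inner1 indicE mem_set// mule1.
exact: measurable_funTS.
Qed.

End tonelli_on_sets.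

(** * Riesz potentials of finite measures *)

Section potentials_of_finite_measures.
Context {R : realType} {n : nat}.
Local Notation leb := (lebesgue_rV R n).
Variable nu : {finite_measure set 'rV[R]_n -> \bar R}.
Implicit Types (x y z : 'rV[R]_n) (g a q eta theta : R) (O : set 'rV[R]_n).

Definition potential g x : \bar R := (\int[nu]_y (riesz_kernel g x y)%:E)%E.

Let mk g : measurable_fun setT
  (fun p : 'rV[R]_n * 'rV[R]_n => (riesz_kernel g p.1 p.2)%:E).
Proof. by apply/measurable_EFinP; exact: measurable_riesz_kernel. Qed.

Let mkx g x : measurable_fun setT (fun y => riesz_kernel g x y).
Proof.
exact: (measurableT_comp (measurable_riesz_kernel g) (pair1_measurable x)).
Qed.

Let k0 g (p : 'rV[R]_n * 'rV[R]_n) : (0 <= (riesz_kernel g p.1 p.2)%:E)%E.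
Proof. by rewrite lee_fin riesz_kernel_ge0. Qed.

Lemma potential_ge0 g x : (0 <= potential g x)%E.
Proof. by apply: integral_ge0 => y _; rewrite lee_fin riesz_kernel_ge0. Qed.

Lemma measurable_potential g : measurable_fun setT (potential g).
Proof. exact: (measurable_fun_fubini_tonelli_F (m2 := nu) _ (mk g) (k0 g)). Qed.

Lemma measurable_fine_potential g :
  measurable_fun setT (fun x => fine (potential g x)).
Proof.
exact: (measurableT_comp (fine_measurable measurableT) (measurable_potential g)).
Qed.

Lemma fine_measure_pos : exists2 M : R, 0 < M & (nu setT <= M%:E)%E.
Proof.
have nuf : nu setT \is a fin_num by exact: fin_num_measure.
exists (fine (nu setT) + 1); first by rewrite ltr_wpDl// fine_ge0.
by rewrite EFinD fineK// leeDl.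
Qed.

Lemma integral_potential_lty g O : 0 < g < n%:R ->
  measurable O -> (leb O < +oo)%E -> (\int[leb]_(x in O) potential g x < +oo)%E.
Proof.
move=> gn mO Ooo.
have [M M0 hM] := integral_riesz_kernel_le gn mO Ooo.
have := fubini_tonelli_in leb nu mO measurableT
  (mk g) (k0 g).
rewrite /potential /= => ->.
apply: (@le_lt_trans _ _ (\int[nu]_y (cst M%:E) y)%E).
  apply: ge0_le_integral => //.
  - by move=> y _; apply: integral_ge0 => x _; rewrite lee_fin riesz_kernel_ge0.
  - under eq_fun do under eq_integral do rewrite riesz_kernelC.
    exact: (measurable_integral_in leb measurableT mO (mk g) (k0 g)).
rewrite integral_cst//.
have [m m0 hm] := fine_measure_pos.
apply: (@le_lt_trans _ _ (M%:E * m%:E)%E); last by rewrite -EFinM ltry.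
by rewrite lee_wpmul2l.
Qed.

Lemma potential_ae_fin g O : 0 < g < n%:R ->
  measurable O -> (leb O < +oo)%E ->
  {ae leb, forall x, O x -> potential g x \is a fin_num}.
Proof.
move=> gn mO Ooo; apply: integrable_ae => //; apply/integrableP; split.
  by apply: measurable_funTS; exact: measurable_potential.
under eq_integral do rewrite gee0_abs ?potential_ge0//.
exact: integral_potential_lty.
Qed.

Lemma fine_potential_powR_le a q : 0 < a -> 1 <= q ->
  exists2 J : R, 0 <= J & forall x,
   ((`|fine (potential a x)| `^ q)%:E <= J%:E * potential (a * q) x)%E.
Proof.
move=> a0 q1; have [m m0 hm] := fine_measure_pos.
exists (m^-1 * (2 * m) `^ q) => [|x].
  by rewrite mulr_ge0 ?powR_ge0// invr_ge0 ltW.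
have -> : potential (a * q) x = (\int[nu]_y (riesz_kernel a x y `^ q)%:E)%E.
  by apply: eq_integral => y _; rewrite /riesz_kernel -powRrM mulNr.
apply: powR_integral_le => //.
- by move=> y; exact: riesz_kernel_ge0.
- rewrite ger0_norm ?fine_ge0 ?potential_ge0//.
  exact: fine_le_ge0 (potential_ge0 a x).
Qed.

(** Jensen's inequality moves the q-th power under the integral in y, where
    the pointwise estimate [powRN_diff_powR_le] applies with d = |x - z|. *)
Lemma fine_potential_dist_powR_le a theta q :
  0 < a -> 0 < theta <= 1 -> 1 <= q ->
  exists2 J : R, 0 <= J & forall x z,
   ((`|fine (potential a x) - fine (potential a z)| `^ q)%:E <=
    (J * enorm (x - z) `^ (theta * q))%:E *
      (potential ((a + theta) * q) x + potential ((a + theta) * q) z))%E.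
Proof.
move=> a0 th q1; have [m m0 hm] := fine_measure_pos.
have q0 : 0 < q by exact: lt_le_trans q1.
exists (m^-1 * (2 * m) `^ q * (1 + a) `^ q) => [|x z].
  by rewrite !mulr_ge0 ?powR_ge0// invr_ge0 ltW.
pose h y := `|riesz_kernel a x y - riesz_kernel a z y|.
have mh : measurable_fun setT h.
  by apply: measurableT_comp => //; exact: measurable_funB.
apply: (@le_trans _ _ ((m^-1 * (2 * m) `^ q)%:E * \int[nu]_y (h y `^ q)%:E)%E).
  apply: powR_integral_le => //.
    by move=> y; exact: normr_ge0.
  exact: (dist_fine_integral_le nu (mkx a x) (mkx a z)
    (riesz_kernel_ge0 a x) (riesz_kernel_ge0 a z)).
have : 0 <= m^-1 * (2 * m) `^ q by rewrite mulr_ge0 ?powR_ge0// invr_ge0 ltW.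
move: (m^-1 * (2 * m) `^ q) => J J0.
rewrite -mulrA EFinM -muleA lee_wpmul2l//.
rewrite /potential -ge0_integralD//; try exact/measurable_EFinP;
  try by move=> y _; rewrite lee_fin riesz_kernel_ge0.
rewrite -ge0_integralZl//; first last.
- by rewrite lee_fin mulr_ge0 ?powR_ge0.
- by move=> y _; rewrite -EFinD lee_fin addr_ge0 ?riesz_kernel_ge0.
- by apply: emeasurable_funD; exact/measurable_EFinP.
apply: ge0_le_integral => //.
- by move=> y _; rewrite lee_fin powR_ge0.
- apply/measurable_EFinP; exact: (measurableT_comp (measurable_powR q)).
- apply: emeasurable_funM => //.
  by apply: emeasurable_funD; exact/measurable_EFinP.
- move=> y _; rewrite -EFinD -EFinM lee_fin.
  apply: powRN_diff_powR_le => //; rewrite ?enorm_ge0//.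
  exact: ler_enorm_dist.
Qed.

(** Integrate the kernel first, in the variable that W does not involve; for
    the term W z this takes an exchange of the order of integration. *)
Lemma integral_convolution_lty g O (W : 'rV[R]_n -> \bar R) : 0 < g < n%:R ->
  measurable O -> (leb O < +oo)%E ->
  measurable_fun setT W -> (forall x, 0 <= W x)%E ->
  (\int[leb]_(x in O) W x < +oo)%E ->
  (\int[leb]_(x in O) \int[leb]_(z in O)
    ((W x + W z) * (riesz_kernel g x z)%:E) < +oo)%E.
Proof.
move=> gn mO Ooo mW W0 Woo.
have [M M0 hM] := integral_riesz_kernel_le gn mO Ooo.
have mWk : measurable_fun setT (fun p : 'rV[R]_n * 'rV[R]_n =>
    (W p.1 * (riesz_kernel g p.1 p.2)%:E)%E).
  apply: emeasurable_funM; last exact: mk.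
  exact: (measurableT_comp mW measurable_fst).
have Wk0 (p : 'rV[R]_n * 'rV[R]_n) : (0 <= W p.1 * (riesz_kernel g p.1 p.2)%:E)%E.
  by rewrite mule_ge0.
have mWk' : measurable_fun setT (fun p : 'rV[R]_n * 'rV[R]_n =>
    (W p.2 * (riesz_kernel g p.1 p.2)%:E)%E).
  apply: emeasurable_funM; last exact: mk.
  exact: (measurableT_comp mW measurable_snd).
have Wk'0 (p : 'rV[R]_n * 'rV[R]_n) : (0 <= W p.2 * (riesz_kernel g p.1 p.2)%:E)%E.
  by rewrite mule_ge0.
have ms (F : 'rV[R]_n * 'rV[R]_n -> \bar R) x : measurable_fun setT F ->
    measurable_fun O (fun z => F (x, z)).
  move=> mF; apply: measurable_funTS.
  exact: (measurableT_comp mF (pair1_measurable x)).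
have I1 : (\int[leb]_(x in O) \int[leb]_(z in O)
    (W x * (riesz_kernel g x z)%:E) < +oo)%E.
  apply: (@le_lt_trans _ _ (\int[leb]_(x in O) (W x * M%:E))%E); last first.
    rewrite ge0_integralZr//; last exact: measurable_funTS.
    by rewrite muleC lte_mul_pinfty.
  apply: ge0_le_integral => //.
  - by move=> x _; apply: integral_ge0 => z _; exact: (Wk0 (x, z)).
  - exact: (measurable_integral_in leb mO mO mWk Wk0).
  - by apply: emeasurable_funM => //; exact: measurable_funTS.
  - move=> x _; rewrite ge0_integralZl//; first last.
    + by move=> z _; exact: (k0 g (x, z)).
    + exact: (ms _ x (mk g)).
    rewrite lee_wpmul2l//; under eq_integral do rewrite riesz_kernelC.
    exact: hM.
have I2 : (\int[leb]_(x in O) \int[leb]_(z in O)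
    (W z * (riesz_kernel g x z)%:E) < +oo)%E.
  rewrite (fubini_tonelli_in leb leb mO mO mWk' Wk'0).
  by under eq_integral do under eq_integral do rewrite riesz_kernelC.
rewrite (eq_integral (fun x => \int[leb]_(z in O) (W x * (riesz_kernel g x z)%:E) +
   \int[leb]_(z in O) (W z * (riesz_kernel g x z)%:E))%E); last first.
  move=> x _; rewrite -ge0_integralD//.
  - by apply: eq_integral => z _; rewrite ge0_muleDl.
  - by move=> z _; exact: (Wk0 (x, z)).
  - exact: (ms _ x mWk).
  - by move=> z _; exact: (Wk'0 (x, z)).
  - exact: (ms _ x mWk').
rewrite ge0_integralD//; first by rewrite lte_add_pinfty.
- by move=> x _; apply: integral_ge0 => z _; exact: (Wk0 (x, z)).
- exact: (measurable_integral_in leb mO mO mWk Wk0).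
- by move=> x _; apply: integral_ge0 => z _; exact: (Wk'0 (x, z)).
- exact: (measurable_integral_in leb mO mO mWk' Wk'0).
Qed.

(** The Gagliardo integrand is dominated by (W x + W z) |x - z|^- g2 with g2 =
    n + eta q - theta q. The three numerical hypotheses say that this order
    and that of the potential W are admissible: g2 < n is eta < theta. *)
Lemma frac_sobolev_potential a theta eta q O :
  0 < a -> 0 < theta <= 1 -> 1 <= q -> eta < theta ->
  0 < n%:R + eta * q - theta * q -> (a + theta) * q < n%:R ->
  measurable O -> (leb O < +oo)%E ->
  frac_sobolev eta q O (fun x => fine (potential a x)).
Proof.
move=> a0 th q1 etath g0 atq mO Ooo; have /andP[th0 th1] := th.
have q0 : 0 < q by exact: lt_le_trans q1.
split; first by apply: measurable_funTS; exact: measurable_fine_potential.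
- have [J J0 hJ] := fine_potential_powR_le a0 q1.
  apply: (@le_lt_trans _ _ (\int[leb]_(x in O) (J%:E * potential (a * q) x))%E).
    apply: ge0_le_integral => //.
    + apply: measurable_funTS; apply/measurable_EFinP.
      apply: (measurableT_comp (measurable_powR q)).
      by apply: measurableT_comp => //; exact: measurable_fine_potential.
    + apply: measurable_funTS; apply: emeasurable_funM => //.
      exact: measurable_potential.
  rewrite ge0_integralZl//; first last.
  + by move=> x _; exact: potential_ge0.
  + by apply: measurable_funTS; exact: measurable_potential.
  have Iy : (\int[leb]_(x in O) potential (a * q) x < +oo)%E.
    apply: integral_potential_lty => //; rewrite mulr_gt0//=.
    by rewrite (lt_trans _ atq)// ltr_pM2r// ltrDl.
  have I0 : (0 <= \int[leb]_(x in O) potential (a * q) x)%E.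
    by apply: integral_ge0 => x _; exact: potential_ge0.
  by rewrite lte_mul_pinfty// ge0_fin_numE.
have [J J0 hJ] := fine_potential_dist_powR_le a0 th q1.
set W := potential ((a + theta) * q) in hJ.
set g2 := n%:R + eta * q - theta * q in g0.
have W0 x : (0 <= W x)%E by exact: potential_ge0.
have mW : measurable_fun setT W by exact: measurable_potential.
have Woo : (\int[leb]_(x in O) W x < +oo)%E.
  apply: integral_potential_lty => //; rewrite atq andbT mulr_gt0//.
  by rewrite addr_gt0.
have g2n : 0 < g2 < n%:R.
  by rewrite g0 /g2 -addrA -ltrBrDl subrr subr_lt0 ltr_pM2r.
have := integral_convolution_lty g2n mO Ooo mW W0 Woo.
set I := (X in (X < +oo)%E -> _) => Ioo.
have mF : measurable_fun setT (fun p : 'rV[R]_n * 'rV[R]_n =>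
    ((W p.1 + W p.2) * (riesz_kernel g2 p.1 p.2)%:E)%E).
  apply: emeasurable_funM; last exact: mk.
  by apply: emeasurable_funD; [exact: (measurableT_comp mW measurable_fst)|
    exact: (measurableT_comp mW measurable_snd)].
have F0 (p : 'rV[R]_n * 'rV[R]_n) :
    (0 <= (W p.1 + W p.2) * (riesz_kernel g2 p.1 p.2)%:E)%E.
  by rewrite mule_ge0// adde_ge0.
pose G (p : 'rV[R]_n * 'rV[R]_n) : \bar R :=
  (`|fine (potential a p.1) - fine (potential a p.2)| `^ q /
     enorm (p.1 - p.2) `^ (n%:R + eta * q))%:E.
have mG : measurable_fun setT G.
  apply/measurable_EFinP; apply: measurable_funM.
    apply: (measurableT_comp (measurable_powR q)).
    apply: measurableT_comp => //; apply: measurable_funB.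
      exact: (measurableT_comp (measurable_fine_potential a) measurable_fst).
    exact: (measurableT_comp (measurable_fine_potential a) measurable_snd).
  rewrite (_ : (fun p => _) = (fun p : 'rV[R]_n * 'rV[R]_n =>
    riesz_kernel (n%:R + eta * q) p.1 p.2)); first exact: measurable_riesz_kernel.
  by apply/funext => p; rewrite /riesz_kernel powRN.
have G0 p : (0 <= G p)%E by rewrite lee_fin divr_ge0 ?powR_ge0.
have GF x z : (G (x, z) <= J%:E * ((W x + W z) * (riesz_kernel g2 x z)%:E))%E.
  rewrite /G/=; have [->|xz] := eqVneq x z.
    rewrite subrr normr0 powR0 ?gt_eqF// mul0r mule_ge0//.
    exact: (F0 (z, z)).
  have d0 : 0 < enorm (x - z).
    rewrite lt_neqAle enorm_ge0 andbT eq_sym; apply: contra_neq xz.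
    by move/enorm_eq0/eqP; rewrite subr_eq0 => /eqP.
  rewrite EFinM (@le_trans _ _ ((J * enorm (x - z) `^ (theta * q))%:E *
      (W x + W z) * ((enorm (x - z) `^ (n%:R + eta * q))^-1)%:E)%E)//.
    by rewrite lee_wpmul2r// lee_fin invr_ge0 powR_ge0.
  rewrite [X in (X <= _)%E](_ : _ = J%:E * ((W x + W z) *
      (enorm (x - z) `^ (theta * q) / enorm (x - z) `^ (n%:R + eta * q))%:E))%E;
    last first.
    by rewrite !EFinM -!muleA; congr (_ * _)%E; rewrite muleCA.
  have -> // : enorm (x - z) `^ (theta * q) / enorm (x - z) `^ (n%:R + eta * q) =
     riesz_kernel g2 x z.
  rewrite /riesz_kernel /g2 -powRN -powRD ?(gt_eqF d0) ?implybT//.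
  by congr powR; ring.
apply: (@le_lt_trans _ _ (J%:E * I)%E); last first.
  have I0 : (0 <= I)%E.
    by apply: integral_ge0 => x _; apply: integral_ge0 => z _; exact: (F0 (x, z)).
  by rewrite lte_mul_pinfty// ge0_fin_numE.
rewrite /I -ge0_integralZl//; first last.
- by move=> x _; apply: integral_ge0 => z _; exact: (F0 (x, z)).
- exact: (measurable_integral_in leb mO mO mF F0).
apply: ge0_le_integral => //.
- by move=> x _; apply: integral_ge0 => z _; exact: (G0 (x, z)).
- exact: (measurable_integral_in leb mO mO mG G0).
- by apply: emeasurable_funM => //; exact: (measurable_integral_in leb mO mO mF F0).
move=> x _; rewrite -ge0_integralZl//; first last.
- by move=> z _; exact: (F0 (x, z)).
- apply: measurable_funTS; exact: (measurableT_comp mF (pair1_measurable x)).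
apply: ge0_le_integral => //.
- by move=> z _; exact: (G0 (x, z)).
- apply: measurable_funTS; exact: (measurableT_comp mG (pair1_measurable x)).
- apply: emeasurable_funM => //; apply: measurable_funTS.
  exact: (measurableT_comp mF (pair1_measurable x)).
- by move=> z _; exact: GF.
Qed.

End potentials_of_finite_measures.

(** * Linear combinations, and pairing of a potential with a bounded function *)

Section frac_sobolev_linear.
Context {R : realType} {n : nat}.
Local Notation leb := (lebesgue_rV R n).

(** The inequality |c (r - t)|^q <= K (|r|^q + |t|^q), applied to values and
    to increments. *)
Lemma frac_sobolev_scaled_sub (eta q c : R) (O : set 'rV[R]_n)
    (u v : 'rV[R]_n -> R) : 0 < q -> measurable O ->
  measurable_fun setT u -> measurable_fun setT v ->
  frac_sobolev eta q O u -> frac_sobolev eta q O v ->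
  frac_sobolev eta q O (fun x => c * (u x - v x)).
Proof.
move=> q0 mO mu mv [_ u1 u2] [_ v1 v2].
have [K K0 key] : exists2 K : R, 0 <= K &
    forall r t, `|c * (r - t)| `^ q <= K * (`|r| `^ q + `|t| `^ q).
  exists ((2 * `|c|) `^ q) => [|r t]; first exact: powR_ge0.
  rewrite normrM powRM// powRM//.
  rewrite [2 `^ q * _]mulrC -mulrA ler_wpM2l ?powR_ge0//.
  apply: le_trans (powR_add_le (ltW q0) (normr_ge0 r) (normr_ge0 t)).
  by rewrite ge0_ler_powR ?nnegrE ?addr_ge0 ?(ltW q0)// ler_normB.
have mq (f : 'rV[R]_n -> R) : measurable_fun setT f ->
    measurable_fun setT (fun x => (`|f x| `^ q)%:E).
  move=> mf; apply/measurable_EFinP.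
  by apply: (measurableT_comp (measurable_powR q)); exact: measurableT_comp.
pose w x := c * (u x - v x).
have mw : measurable_fun setT w.
  by apply: measurable_funM => //; exact: measurable_funB.
have q_ge0 (f : 'rV[R]_n -> R) x : (0 <= (`|f x| `^ q)%:E)%E.
  by rewrite lee_fin powR_ge0.
have mqO f mf := @measurable_funTS _ _ _ _ O _ (mq f mf).
split; first exact: (@measurable_funTS _ _ _ _ O _ mw).
  apply: (@le_lt_trans _ _ (\int[leb]_(x in O)
    (K%:E * ((`|u x| `^ q)%:E + (`|v x| `^ q)%:E)))%E).
    apply: (ge0_le_integral leb mO (fun x _ => q_ge0 w x) (mqO _ mw)).
      apply: emeasurable_funM; first exact: measurable_cst.
      exact: (emeasurable_funD (mqO _ mu) (mqO _ mv)).
    by move=> x _; rewrite -EFinD -EFinM lee_fin; exact: key.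
  rewrite (ge0_integralZl leb mO (emeasurable_funD (mqO _ mu) (mqO _ mv))
    (fun x _ => adde_ge0 (q_ge0 u x) (q_ge0 v x))) ?lee_fin//.
  rewrite (ge0_integralD leb mO (fun x _ => q_ge0 u x) (mqO _ mu)
    (fun x _ => q_ge0 v x) (mqO _ mv)).
  by apply: lte_mul_pinfty; [rewrite lee_fin| |exact: (lte_add_pinfty u1 v1)].
set e := n%:R + eta * q in u2 v2 *.
pose G (f : 'rV[R]_n -> R) (p : 'rV[R]_n * 'rV[R]_n) : \bar R :=
  (`|f p.1 - f p.2| `^ q / enorm (p.1 - p.2) `^ e)%:E.
have G0 f p : (0 <= G f p)%E by rewrite lee_fin divr_ge0 ?powR_ge0.
have mG f : measurable_fun setT f -> measurable_fun setT (G f).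
  move=> mf; apply/measurable_EFinP; apply: measurable_funM.
    apply: (measurableT_comp (measurable_powR q)).
    apply: measurableT_comp => //; apply: measurable_funB.
      exact: (measurableT_comp mf measurable_fst).
    exact: (measurableT_comp mf measurable_snd).
  rewrite (_ : (fun p => _) = (fun p : 'rV[R]_n * 'rV[R]_n =>
    riesz_kernel e p.1 p.2)); first exact: measurable_riesz_kernel.
  by apply/funext => p; rewrite /riesz_kernel powRN.
have mI f : measurable_fun setT f ->
    measurable_fun O (fun x => \int[leb]_(z in O) G f (x, z))%E.
  by move=> mf; exact: (measurable_integral_in leb mO mO (mG f mf) (G0 f)).
have ms f x : measurable_fun setT f -> measurable_fun O (fun z => G f (x, z)).
  move=> mf; apply: measurable_funTS.
  exact: (measurableT_comp (mG f mf) (pair1_measurable x)).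
pose I f x := (\int[leb]_(z in O) G f (x, z))%E.
have I0 f x : (0 <= I f x)%E by apply: integral_ge0 => z _; exact: G0.
have Iw x : (I w x <= K%:E * (I u x + I v x))%E.
  rewrite /I -(ge0_integralD leb mO (fun z _ => G0 u (x, z)) (ms u x mu)
    (fun z _ => G0 v (x, z)) (ms v x mv)).
  rewrite -(ge0_integralZl leb mO (emeasurable_funD (ms u x mu) (ms v x mv))
    (fun z _ => adde_ge0 (G0 u (x, z)) (G0 v (x, z)))) ?lee_fin//.
  apply: (ge0_le_integral leb mO (fun z _ => G0 w (x, z)) (ms w x mw)).
    apply: emeasurable_funM; first exact: measurable_cst.
    exact: (emeasurable_funD (ms u x mu) (ms v x mv)).
  move=> z _; rewrite /G/= -EFinD -EFinM lee_fin -mulrDl mulrA.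
  rewrite ler_wpM2r ?invr_ge0 ?powR_ge0// /w -mulrBr.
  rewrite (_ : u x - v x - (u z - v z) = u x - u z - (v x - v z)); last by ring.
  exact: key.
apply: (@le_lt_trans _ _ (\int[leb]_(x in O) (K%:E * (I u x + I v x)))%E).
  apply: (ge0_le_integral leb mO (fun x _ => I0 w x) (mI w mw)).
    apply: emeasurable_funM; first exact: measurable_cst.
    exact: (emeasurable_funD (mI u mu) (mI v mv)).
  by move=> x _; exact: Iw.
rewrite (ge0_integralZl leb mO (emeasurable_funD (mI u mu) (mI v mv))
  (fun x _ => adde_ge0 (I0 u x) (I0 v x))) ?lee_fin//.
rewrite (ge0_integralD leb mO (fun x _ => I0 u x) (mI u mu)
  (fun x _ => I0 v x) (mI v mv)).
by apply: lte_mul_pinfty; [rewrite lee_fin| |exact: (lte_add_pinfty u2 v2)].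
Qed.

End frac_sobolev_linear.

Section duality_pairing.
Context {R : realType} {n : nat}.
Local Notation leb := (lebesgue_rV R n).
Variable nu : {finite_measure set 'rV[R]_n -> \bar R}.
Variables (a B : R) (O : set 'rV[R]_n) (g : 'rV[R]_n -> R).
Hypotheses (an : 0 < a < n%:R) (mO : measurable O) (Ooo : (leb O < +oo)%E).
Hypotheses (mg : measurable_fun setT g) (gB : forall x, `|g x| <= B).
Hypothesis (gO : forall x, ~ O x -> g x = 0).

Let B0 : 0 <= B. Proof. exact: le_trans (normr_ge0 _) (gB 0). Qed.

Let h (p : 'rV[R]_n * 'rV[R]_n) : \bar R := (g p.1 * riesz_kernel a p.1 p.2)%:E.

Let mh : measurable_fun setT h.
Proof.
apply/measurable_EFinP; apply: measurable_funM.
  exact: (measurableT_comp mg measurable_fst).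
exact: measurable_riesz_kernel.
Qed.

Let mhx x : measurable_fun setT (fun y => h (x, y)).
Proof. exact: (measurableT_comp mh (pair1_measurable x)). Qed.

Let mhy y : measurable_fun setT (fun x => h (x, y)).
Proof. exact: (measurableT_comp mh (pair2_measurable y)). Qed.

Let mahx x : measurable_fun setT (fun y => `|h (x, y)|%E).
Proof.
by apply: (measurableT_comp (f := abse)); [exact: abse_measurable|exact: mhx].
Qed.

Let mahy y : measurable_fun setT (fun x => `|h (x, y)|%E).
Proof.
by apply: (measurableT_comp (f := abse)); [exact: abse_measurable|exact: mhy].
Qed.

Let mkx (x : 'rV[R]_n) : measurable_fun setT (fun y => (riesz_kernel a x y)%:E).
Proof.
apply/measurable_EFinP.
exact: (measurableT_comp (measurable_riesz_kernel a) (pair1_measurable x)).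
Qed.

Let mP : measurable_fun setT (potential nu a).
Proof. exact: measurable_potential. Qed.

(* An integrable function dominating the potential times g. *)
Let dom x : \bar R := (B%:E * potential nu a x * (\1_O x)%:E)%E.

Let dom_int : leb.-integrable setT dom.
Proof.
apply/integrableP; split.
  apply: emeasurable_funM; first exact: emeasurable_funM.
  by apply/measurable_EFinP; exact: measurable_indic.
rewrite (eq_integral dom); last first.
  by move=> x _; rewrite gee0_abs// /dom !mule_ge0// ?lee_fin// potential_ge0.
rewrite -integral_indicE ge0_integralZl//.
- rewrite lte_mul_pinfty//; exact: integral_potential_lty.
- exact: measurable_funTS.
- by move=> x _; exact: potential_ge0.
Qed.

Let ae_fin : {ae leb, forall x, O x -> potential nu a x \is a fin_num}.
Proof. exact: potential_ae_fin. Qed.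

Let ih : (leb \x nu)%E.-integrable setT h.
Proof.
apply/(integrable12ltyP leb nu mh).
have /integrableP[_] := dom_int; apply: le_lt_trans.
apply: ge0_le_integral => //.
- by move=> x _; exact: integral_ge0.
- apply: (measurable_fun_fubini_tonelli_F (m2 := nu) (abse \o h)) => //=.
  by apply: measurableT_comp => //; exact: mh.
- by apply: measurableT_comp => //; exact: measurable_int dom_int.
move=> x _; rewrite gee0_abs; last first.
  by rewrite /dom !mule_ge0// ?lee_fin// potential_ge0.
have [xO|xO] := pselect (O x); last first.
  rewrite integral0_eq; first by rewrite /dom !mule_ge0// ?lee_fin// potential_ge0.
  by move=> y _; rewrite /h/= gO// mul0r normr0.
rewrite /dom indicE mem_set// mule1 /potential.
rewrite -(ge0_integralZl nu measurableT (mkx x)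
  (fun y _ => riesz_kernel_ge0 a x y : (0 <= (_)%:E)%E)) ?lee_fin//.
apply: (ge0_le_integral nu measurableT (fun y _ => abse_ge0 _) (mahx x)).
  by apply: emeasurable_funM; [exact: measurable_cst|exact: mkx].
move=> y _; rewrite /h/= lee_fin normrM (ger0_norm (riesz_kernel_ge0 _ _ _)).
by rewrite ler_wpM2r ?riesz_kernel_ge0.
Qed.

Lemma integrable_potentialM :
  leb.-integrable setT (fun x => (fine (potential nu a x) * g x)%:E).
Proof.
apply: le_integrable dom_int => //.
  apply/measurable_EFinP; apply: measurable_funM => //.
  exact: measurable_fine_potential.
move=> x _; rewrite [leRHS]gee0_abs; last first.
  by rewrite /dom !mule_ge0// ?lee_fin// potential_ge0.
have [xO|xO] := pselect (O x); last first.
  by rewrite gO// mulr0 abse0 /dom !mule_ge0// ?lee_fin// potential_ge0.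
rewrite /dom indicE mem_set// mule1 mulrC EFinM abseM.
rewrite lee_pmul//; first by rewrite lee_fin.
have f0 : 0 <= fine (potential nu a x) by rewrite fine_ge0// potential_ge0.
by rewrite gee0_abs ?lee_fin// fine_le_ge0 ?potential_ge0.
Qed.

Let Gfin : exists2 K : R, 0 <= K & forall y, (\int[leb]_x `|h (x, y)| <= K%:E)%E.
Proof.
have [M M0 hM] := integral_riesz_kernel_le an mO Ooo.
exists (B * M) => [|y]; first exact: mulr_ge0.
apply: (@le_trans _ _
  (\int[leb]_x (B%:E * (riesz_kernel a x y)%:E * (\1_O x)%:E))%E).
  apply: (ge0_le_integral leb measurableT (fun x _ => abse_ge0 _) (mahy y)).
  - apply/measurable_EFinP; apply: measurable_funM; last exact: measurable_indic.
    apply: measurable_funM; first exact: measurable_cst.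
    exact: measurable_riesz_kernel1.
  - move=> x _; rewrite /h/= -!EFinM lee_fin normrM.
    rewrite (ger0_norm (riesz_kernel_ge0 _ _ _)).
    have [xO|xO] := pselect (O x).
      by rewrite indicE mem_set// mulr1 ler_wpM2r ?riesz_kernel_ge0.
    by rewrite gO// normr0 mul0r !mulr_ge0// riesz_kernel_ge0.
rewrite -integral_indicE ge0_integralZl//; first last.
- by move=> x _; rewrite lee_fin riesz_kernel_ge0.
- apply/measurable_EFinP; apply: measurable_funTS; exact: measurable_riesz_kernel1.
by rewrite EFinM lee_wpmul2l.
Qed.

Let w y : R := \int[leb]_x (g x * riesz_kernel a x y).

Let wE y : (w y)%:E = (\int[leb]_x h (x, y))%E.
Proof.
have [K K0 hK] := Gfin.
rewrite /w /Rintegral fineK//; apply: (integrable_fin_num measurableT).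
apply/integrableP; split; first exact: mhy.
by apply: le_lt_trans (hK y) _; rewrite ltry.
Qed.

(** The transform of g is bounded, by B times the uniform bound of
    [integral_riesz_kernel_le]. *)
Lemma integrable_riesz_transform : nu.-integrable setT (fun y => (w y)%:E).
Proof.
have [K K0 hK] := Gfin.
have mw : measurable_fun setT w.
  apply/measurable_EFinP; rewrite (_ : EFin \o w = fubini_G leb h).
    exact: (measurable_fubini_G ih).
  by apply/funext => y; exact: wE.
apply: measurable_bounded_integrable => //.
  by rewrite -ge0_fin_numE ?fin_num_measure.
exists K; split; first by rewrite num_real.
move=> M KM y _ /=; rewrite (le_trans _ (ltW KM))// -lee_fin.
rewrite (_ : `|w y|%:E = `|(w y)%:E|%E)// wE.
apply: le_trans (hK y).
exact: (le_abse_integral leb measurableT (mhy y)).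
Qed.

(** Fubini's theorem for g(x) |x - y|^-a. The potential may be infinite on a
    null subset of O, where fine replaces it by 0. *)
Lemma potential_duality :
  \int[leb]_x (fine (potential nu a x) * g x) = \int[nu]_y w y.
Proof.
rewrite /Rintegral; congr fine.
rewrite [RHS](eq_integral (fun y => \int[leb]_x h (x, y))%E); last first.
  by move=> y _; exact: wE.
rewrite -(Fubini ih); apply: ae_eq_integral => //.
- by have /integrableP[] := integrable_potentialM.
- exact: (measurable_fubini_F ih).
apply: filterS ae_fin => x xfin _ /=.
have [xO|xO] := pselect (O x); last first.
  by rewrite gO// mulr0 integral0_eq// => y _; rewrite /h/= gO// mul0r.
have {}xfin := xfin xO.
rewrite /h/=; under eq_integral do rewrite EFinM.
rewrite integralZl//; last first.
  apply/integrableP; split.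
    exact: mkx.
  under eq_integral do rewrite gee0_abs ?lee_fin ?riesz_kernel_ge0//.
  by rewrite -/(potential nu a x) -ge0_fin_numE ?potential_ge0.
by rewrite -/(potential nu a x) mulrC EFinM fineK.
Qed.

End duality_pairing.

(** * Flat functions on the line *)

Section flat_functions.
Context {R : realType}.
Implicit Types (t : R) (k : nat).

(** The powers of 1/t are included so that the family is closed under
    differentiation, up to linear combinations. *)
Definition flat k t : R := if 0 < t then t^-1 ^+ k * expR (- t^-1) else 0.

Lemma flat_le0 k t : t <= 0 -> flat k t = 0.
Proof. by rewrite /flat leNgt => /negbTE->. Qed.

Lemma flat_ge0 k t : 0 <= flat k t.
Proof.
rewrite /flat; case: ifPn => // t0.
by rewrite mulr_ge0 ?expR_ge0 ?exprn_ge0 ?invr_ge0 ?ltW.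
Qed.

Lemma flat_gt0 k t : (0 < flat k t) = (0 < t).
Proof.
rewrite /flat; case: ifPn => t0; last by rewrite ltxx.
by rewrite mulr_gt0 ?expR_gt0 ?exprn_gt0 ?invr_gt0.
Qed.

Lemma flat0_lt1 t : flat 0 t < 1.
Proof.
rewrite /flat; case: ifPn => // t0.
by rewrite expr0 mul1r expR_lt1 oppr_lt0 invr_gt0.
Qed.

(** The term of degree k + 2 of the exponential series at 1/t beats t^-k. *)
Lemma flat_le_sqr k t : flat k t <= (k.+2)`!%:R * t ^+ 2.
Proof.
rewrite /flat; case: ifPn => [t0|_]; last by rewrite mulr_ge0 ?sqr_ge0.
have x0 : 0 < t^-1 by rewrite invr_gt0.
have := expR_ge1Dxn k.+1 (ltW x0) => h.
have {}h : t^-1 ^+ k.+2 / (k.+2)`!%:R <= expR t^-1.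
  by apply: le_trans h; rewrite lerDr.
rewrite expRN ler_pdivrMr ?expR_gt0//.
have f0 : 0 < (k.+2)`!%:R :> R by rewrite ltr0n fact_gt0.
apply: (@le_trans _ _ ((k.+2)`!%:R * t ^+ 2 * (t^-1 ^+ k.+2 / (k.+2)`!%:R))).
  rewrite -addn2 exprD; move: (t^-1 ^+ k) => X.
  rewrite (_ : _ * (X * _ / _) = X)//.
  by field; rewrite !gt_eqF.
by rewrite ler_wpM2l// mulr_ge0 ?sqr_ge0// ltW.
Qed.

Lemma flat_continuous0 k : {for 0, continuous (flat k)}.
Proof.
suff : flat k t @[t --> (0 : R)] --> flat k 0 by [].
rewrite [X in _ --> X](flat_le0 k (lexx 0)).
apply: (squeeze_cvgr (f := fun=> 0) (h := fun t => (k.+2)`!%:R * t ^+ 2)).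
- by apply: nearW => t; rewrite flat_ge0 flat_le_sqr.
- exact: cvg_cst.
- rewrite -[X in _ --> X](mulr0 (k.+2)`!%:R).
  apply: cvgM; first exact: cvg_cst.
  have : t ^+ 2 @[t --> (0 : R)] --> (0 : R) ^+ 2 by exact: exprn_continuous.
  by rewrite expr0n.
Qed.

(** At the origin the slope of flat k is flat k.+1, which is continuous there
    by [flat_le_sqr]; hence Caratheodory's criterion. *)
Lemma is_derive_flat k t :
  is_derive t 1 (flat k) (flat k.+2 t - k%:R * flat k.+1 t).
Proof.
have [t0|t0|->] := ltgtP t 0.
- rewrite !flat_le0 ?(ltW t0)// mulr0 subr0.
  apply: (near_eq_is_derive (f := (cst 0 : R -> R))).
  near=> z; rewrite flat_le0// ltW//; near: z.
  exact: lt_nbhsl.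
- apply: (near_eq_is_derive (f := (fun z : R => z^-1 ^+ k * expR (- z^-1)))).
    by near=> z; rewrite /flat ifT//; near: z; exact: lt_nbhsr.
  have dV : is_derive t (1 : R) (fun z : R => z^-1) (- t ^- 2 *: (1 : R)).
    by apply: is_deriveV; rewrite ?gt_eqF//; exact: is_derive_id.
  have dX := is_deriveX k dV.
  have dE : is_derive t (1 : R) (expR \o (- (fun z : R => z^-1)))
      (expR (- t^-1) * - (- t ^- 2 *: (1 : R))).
    by apply: is_derive1_comp; exact: is_derive_expR.
  have -> : (fun z : R => z^-1 ^+ k * expR (- z^-1)) =
      ((fun z : R => z^-1) ^+ k) * (expR \o (- (fun z : R => z^-1))).
    by rewrite exprfctE.
  have := is_deriveM dX dE.
  move=> /is_derive_eq; apply.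
  rewrite /flat t0 /GRing.scale/= /GRing.scale/= -exprVn.
  rewrite exprfctE -[(- _) t]/(- t^-1).
  by case: k {dX} => [|k]; rewrite ?exprS ?expr0 /=; ring.
- rewrite !flat_le0// mulr0 subr0.
  apply/is_derive1_caratheodory; exists (flat k.+1); split.
  + move=> z; rewrite (flat_le0 _ (lexx 0)) !subr0 /flat; case: ifPn => z0.
      rewrite exprS; move: (z^-1 ^+ k) (expR _) => X E.
      by field; rewrite gt_eqF.
    by rewrite mul0r.
  + exact: flat_continuous0.
  + exact: flat_le0.
Unshelve. all: by end_near. Qed.

Lemma flat_continuous k : continuous (flat k).
Proof.
move=> t; apply: differentiable_continuous; apply/derivable1_diffP.
exact: (@ex_derive _ _ _ _ _ _ _ (is_derive_flat k t)).
Qed.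

End flat_functions.

(** * Smooth functions with compact support *)

Section flat_algebra.
Context {R : realType} {n : nat}.
Implicit Types (f g : 'rV[R]_n -> R) (x : 'rV[R]_n).

(** An algebra of continuous functions stable under partial derivatives
    consists of smooth functions; this one is rich enough to contain cut-offs
    of boxes. *)
Inductive flat_algebra : ('rV[R]_n -> R) -> Prop :=
| flat_algebra_cst (r : R) : flat_algebra (fun=> r)
| flat_algebra_flat k (r b : R) i :
    flat_algebra (fun x => flat k (r * x 0 i + b))
| flat_algebraD f g : flat_algebra f -> flat_algebra g ->
    flat_algebra (fun x => f x + g x)
| flat_algebraM f g : flat_algebra f -> flat_algebra g ->
    flat_algebra (fun x => f x * g x).

(** A directional derivative is the derivative at 0 along the line. *)
Lemma is_derive_line f x v (l : R) :
  is_derive (0 : R) 1 (fun h => f (h *: v + x)) l -> is_derive x v f l.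
Proof.
have E : (fun h : R => h^-1 *: ((f \o shift x) (h *: v) - f x)) =
  (fun h : R => h^-1 *: (((fun h => f (h *: v + x)) \o shift 0) (h *: 1) -
    f (0 *: v + x))).
  by apply/funext => h /=; rewrite addr0 scale0r add0r [_%:A]mulr1.
move=> [dl Dl]; split; first exact/derivable1P.
by rewrite -Dl /derive E.
Qed.

Lemma flat_algebra_derive f : flat_algebra f -> forall i,
  exists2 g, flat_algebra g & forall x, is_derive x (delta_mx 0 i) f (g x).
Proof.
elim=> [r i|k r b j i|{}f g _ IHf _ IHg i|{}f g ff IHf fg IHg i].
- exists (fun=> 0) => [|x]; first exact: flat_algebra_cst.
  exact: is_derive_cst.
- pose l := r * (delta_mx 0 i : 'rV[R]_n) 0 j.
  exists (fun x => l * (flat k.+2 (r * x 0 j + b) +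
      (- k%:R) * flat k.+1 (r * x 0 j + b))).
    apply: flat_algebraM; first exact: flat_algebra_cst.
    apply: flat_algebraD; first exact: flat_algebra_flat.
    by apply: flat_algebraM; [exact: flat_algebra_cst|exact: flat_algebra_flat].
  move=> x; apply: is_derive_line.
  rewrite (_ : (fun h => _) = flat k \o (fun h : R => l * h + (r * x 0 j + b)));
    last first.
    by apply/funext => h /=; rewrite !mxE /l; congr flat; rewrite !mxE; ring.
  have da : is_derive (0 : R) 1 (fun h : R => l * h + (r * x 0 j + b)) l.
    have h1 : is_derive (0 : R) (1 : R) (l \*: (@id R)) (l *: (1 : R)).
      by apply: is_deriveZ; exact: is_derive_id.
    have h2 := is_deriveD h1 (is_derive_cst (r * x 0 j + b) 0 (1 : R)).
    by move: h2 => /is_derive_eq; apply; rewrite addr0 [_ *: _]mulr1.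
  have dF := is_derive_flat k (l * 0 + (r * x 0 j + b)).
  have := is_derive1_comp (g := fun h : R => l * h + (r * x 0 j + b)) dF da.
  by move=> /is_derive_eq; apply; rewrite mulr0 add0r mulrC mulNr.
- have [f' Af' df] := IHf i; have [g' Ag' dg] := IHg i.
  exists (fun x => f' x + g' x) => [|x]; first exact: flat_algebraD.
  exact: (is_deriveD (df x) (dg x)).
- have [f' Af' df] := IHf i; have [g' Ag' dg] := IHg i.
  exists (fun x => f x * g' x + g x * f' x) => [|x].
    by apply: flat_algebraD; exact: flat_algebraM.
  exact: (is_deriveM (df x) (dg x)).
Qed.

Lemma flat_algebra_continuous f : flat_algebra f -> continuous f.
Proof.
elim=> [r|k r b j|{}f g _ cf _ cg|{}f g _ cf _ cg] x.
- exact: cst_continuous.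
- apply: (@continuous_comp _ _ _ (fun x : 'rV[R]_n => r * x 0 j + b) (flat k));
    last exact: flat_continuous.
  apply: continuousD; last exact: cst_continuous.
  by apply: continuousM; [exact: cst_continuous|exact: coord_continuous].
- by apply: continuousD; [exact: cf|exact: cg].
- by apply: continuousM; [exact: cf|exact: cg].
Qed.

Lemma flat_algebra_partials l f : flat_algebra f -> flat_algebra (partials l f).
Proof.
move=> Af; elim: l => [//|i l IHl].
have [g Ag dg] := flat_algebra_derive IHl i.
rewrite [partials _ _](_ : _ = g)//.
by apply/funext => x; have [_ <-] := dg x.
Qed.

Lemma flat_algebra_smooth f : flat_algebra f -> smooth f.
Proof.
move=> Af l; have Al := flat_algebra_partials l Af; split.
  exact: flat_algebra_continuous.
by move=> i x; have [g _ dg] := flat_algebra_derive Al i; by have [] := dg x.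
Qed.

Lemma flat_algebra_prod (s : seq 'I_n) (F : 'I_n -> 'rV[R]_n -> R) :
  (forall i, flat_algebra (F i)) -> flat_algebra (fun x => \prod_(i <- s) F i x).
Proof.
move=> AF; elim: s => [|i s IHs].
  under eq_fun do rewrite big_nil; exact: flat_algebra_cst.
by under eq_fun do rewrite big_cons; exact: flat_algebraM.
Qed.

Lemma flat_algebraX f k : flat_algebra f -> flat_algebra (fun x => f x ^+ k).
Proof.
move=> Af; elim: k => [|k IHk].
  under eq_fun do rewrite expr0; exact: flat_algebra_cst.
by under eq_fun do rewrite exprS; exact: flat_algebraM.
Qed.

Lemma flat_algebra_onem f : flat_algebra f -> flat_algebra (fun x => 1 - f x).
Proof.
move=> Af; under eq_fun do rewrite -mulN1r.
apply: flat_algebraD; first exact: flat_algebra_cst.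
by apply: flat_algebraM => //; exact: flat_algebra_cst.
Qed.

End flat_algebra.

Section open_boxes.
Context {R : realType} {n : nat}.
Implicit Types (a b x : 'rV[R]_n).

Definition obox a b : set 'rV[R]_n := [set x | forall i, a 0 i < x 0 i < b 0 i].

Definition cbox a b : set 'rV[R]_n := [set x | forall i, a 0 i <= x 0 i <= b 0 i].

(** Positive exactly on the open box, and smooth. *)
Definition bump a b x : R :=
  \prod_i (flat 0 (x 0 i - a 0 i) * flat 0 (b 0 i - x 0 i)).

(** Powers of 1 - bump tend to 0 on the open box and are 1 outside, so that
    these functions tend to the indicator of the box and vanish outside it. *)
Definition plateau a b (k : nat) x : R := 1 - (1 - bump a b x) ^+ k.

Lemma bump_ge0 a b x : 0 <= bump a b x.
Proof. by apply: prodr_ge0 => i _; rewrite mulr_ge0 ?flat_ge0. Qed.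

Lemma bump_le1 a b x : bump a b x <= 1.
Proof.
apply: prodr_ile1 => i _.
rewrite mulr_ge0 ?flat_ge0//= mulr_ile1 ?flat_ge0// ltW// flat0_lt1//.
Qed.

Lemma bump_gt0 a b x : obox a b x -> 0 < bump a b x.
Proof.
move=> abx; apply: prodr_gt0 => i _; have /andP[h1 h2] := abx i.
by rewrite mulr_gt0// flat_gt0 subr_gt0.
Qed.

Lemma bump_eq0 a b x : ~ obox a b x -> bump a b x = 0.
Proof.
move=> /existsNP[i /negP]; rewrite negb_and -!leNgt => h.
apply/eqP; rewrite /bump prodf_seq_eq0; apply/hasP.
exists i; first exact: mem_index_enum.
rewrite mulf_eq0/=; case/orP: h => h; apply/orP; [left|right];
  by rewrite flat_le0// subr_le0.
Qed.

Lemma flat_algebra_bump a b : flat_algebra (bump a b).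
Proof.
apply: flat_algebra_prod => i; apply: flat_algebraM.
  rewrite (_ : (fun x => _) = (fun x : 'rV[R]_n => flat 0 (1 * x 0 i + - a 0 i))).
    exact: flat_algebra_flat.
  by apply/funext => x; congr flat; ring.
rewrite (_ : (fun x => _) = (fun x : 'rV[R]_n => flat 0 (- 1 * x 0 i + b 0 i))).
  exact: flat_algebra_flat.
by apply/funext => x; congr flat; ring.
Qed.

Lemma flat_algebra_plateau a b k : flat_algebra (plateau a b k).
Proof.
apply: flat_algebra_onem; apply: flat_algebraX; apply: flat_algebra_onem.
exact: flat_algebra_bump.
Qed.

Lemma plateau_bounds a b k x : 0 <= plateau a b k x <= 1.
Proof.
have h0 : 0 <= 1 - bump a b x by rewrite subr_ge0 bump_le1.
have h1 : 1 - bump a b x <= 1 by rewrite gerBl bump_ge0.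
by rewrite /plateau subr_ge0 exprn_ile1//= gerBl exprn_ge0.
Qed.

Lemma plateau_out a b k x : ~ obox a b x -> plateau a b k x = 0.
Proof. by move=> /bump_eq0 h; rewrite /plateau h subr0 expr1n subrr. Qed.

Lemma plateau_cvg a b x :
  plateau a b k x @[k --> \oo] --> (\1_(obox a b) x : R).
Proof.
rewrite indicE; have [xb|xb] := pselect (obox a b x); last first.
  rewrite memNset//; under eq_fun do rewrite plateau_out//; exact: cvg_cst.
rewrite mem_set//= -[X in _ --> X]subr0; apply: cvgB; first exact: cvg_cst.
apply: cvg_expr; rewrite ger0_norm ?subr_ge0 ?bump_le1//.
by rewrite gtrBl bump_gt0.
Qed.

Lemma compact_cbox a b : compact (cbox a b).
Proof.
have -> : cbox a b = [set x | forall i, `[a 0 i, b 0 i]%classic (x ord0 i)].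
  by apply/seteqP; split=> x /= h i; have := h i; rewrite /= in_itv.
exact: (@rV_compact R n (fun i => `[a 0 i, b 0 i]%classic)
  (fun i => @segment_compact _ _ _)).
Qed.

Lemma closed_cbox a b : closed (cbox a b).
Proof.
apply: compact_closed; last exact: compact_cbox.
exact: norm_hausdorff.
Qed.

Lemma compact_measurable_rV (K : set 'rV[R]_n) : compact K -> measurable K.
Proof.
move=> cK; rewrite -[K]setCK; apply: measurableC; apply: sub_sigma_algebra.
apply: closed_openC; apply: compact_closed => //; exact: norm_hausdorff.
Qed.

Lemma obox_sub_cbox a b : obox a b `<=` cbox a b.
Proof. by move=> x h i; have /andP[/ltW -> /ltW ->] := h i. Qed.

Lemma test_function_plateau a b k : test_function (plateau a b k).
Proof.
split; first exact/flat_algebra_smooth/flat_algebra_plateau.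
apply: (@subclosed_compact _ _ (cbox a b)).
- exact: closed_closure.
- exact: compact_cbox.
rewrite [X in _ `<=` X](_ : _ = closure (cbox a b)); last first.
  by apply/closure_id; exact: closed_cbox.
apply: closure_subset => x /= /eqP hx; apply: obox_sub_cbox.
by apply: contrapT => /(plateau_out k).
Qed.

Lemma measurable_continuous_rV (f : 'rV[R]_n -> R) :
  continuous f -> measurable_fun setT f.
Proof.
move=> /continuousP cf; apply: (measurability _ (RGenOpens.measurableE R)).
move=> _ [_ [c [d ->] <-]]; rewrite setTI; apply: sub_sigma_algebra.
exact/cf/interval_open.
Qed.

Lemma open_obox a b : open (obox a b).
Proof.
have -> : obox a b = (bump a b) @^-1` `]0, +oo[.
  apply/seteqP; split=> x /=; rewrite in_itv/= andbT; first exact: bump_gt0.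
  by move=> h; apply: contrapT => /bump_eq0 h0; rewrite h0 ltxx in h.
apply: open_comp; last exact: interval_open.
by move=> x _; apply: flat_algebra_continuous; exact: flat_algebra_bump.
Qed.

Lemma measurable_obox a b : measurable (obox a b).
Proof. by apply: sub_sigma_algebra; exact: open_obox. Qed.

End open_boxes.

(** * The fundamental lemma of the calculus of variations *)

Section fundamental_lemma.
Context {R : realType} {n : nat}.
Local Notation leb := (lebesgue_rV R n).
Implicit Types (a b x : 'rV[R]_n) (h : 'rV[R]_n -> R).

Definition oboxes : set (set 'rV[R]_n) := [set obox ab.1 ab.2 | ab in setT].

Lemma oboxes_setI_closed : setI_closed oboxes.
Proof.
move=> _ _ [[a b] _ <-] [[a' b'] _ <-] /=.
exists (\row_i Num.max (a 0 i) (a' 0 i), \row_i Num.min (b 0 i) (b' 0 i)) => //=.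
apply/seteqP; split=> x /=.
  move=> xI; split=> i; have := xI i; rewrite !mxE gt_max lt_min.
    by move=> /andP[/andP[-> _] /andP[-> _]].
  by move=> /andP[/andP[_ ->] /andP[_ ->]].
move=> [x1 x2] i; rewrite !mxE gt_max lt_min.
by have /andP[-> ->] := x1 i; have /andP[-> ->] := x2 i.
Qed.

Lemma mem_centered_obox x :
  exists k : nat, obox (const_mx (- k%:R)) (const_mx k%:R) x.
Proof.
exists (Num.bound (enorm x)) => i; rewrite !mxE -ltr_norml.
by apply: le_lt_trans (normr_coord_le_enorm x i) _; rewrite archi_boundP ?enorm_ge0.
Qed.

(** It suffices that the identity is measurable from the sigma-algebra
    generated by boxes to the Borel one, which is checked on coordinates: a
    half-space is a countable union of boxes. *)
Lemma measurable_oboxes : @measurable _ 'rV[R]_n = <<s oboxes >>.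
Proof.
apply/seteqP; split=> A; last first.
  apply: smallest_sub; first exact: sigma_algebra_measurable.
  by move=> _ [ab _ <-]; exact: measurable_obox.
pose T := g_sigma_algebraType oboxes.
have mid : measurable_fun [set: T] (idfun : T -> 'rV[R]_n).
  apply: measurable_fun_rV => i.
  apply: (measurability _ (RGenOInfty.measurableE R)) => _ [_ [c ->] <-].
  rewrite setTI.
  rewrite [X in measurable X](_ : _ = \bigcup_k
    obox (\row_j (if j == i then c else - k%:R)) (const_mx k%:R)).
    apply: bigcupT_measurable => k; apply: sub_sigma_algebra.
    by exists (\row_j (if j == i then c else - k%:R), const_mx k%:R).
  apply/seteqP; split=> x /=; rewrite in_itv/= andbT.
    move=> cx; have [k xk] := mem_centered_obox x; exists k => //= j.
    have := xk j; rewrite !mxE; case: eqP => [->|//].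
    by rewrite cx => /andP[].
  by move=> [k _ /(_ i)]; rewrite !mxE eqxx => /andP[].
move=> mA; have := mid measurableT A mA.
by rewrite setTI preimage_id.
Qed.

Lemma L1loc_integrable_box h a b : L1loc h ->
  leb.-integrable setT (fun x => (h x * \1_(obox a b) x)%:E).
Proof.
move=> [mh hK]; apply/integrableP; split.
  apply/measurable_EFinP; apply: measurable_funM => //.
  by apply: measurable_indic; exact: measurable_obox.
have mc := compact_measurable_rV (@compact_cbox R n a b).
have := hK _ (@compact_cbox R n a b); apply: le_lt_trans.
rewrite [X in (_ <= X)%E]integral_indicE.
apply: ge0_le_integral => //.
- apply: measurableT_comp => //; apply/measurable_EFinP.
  apply: measurable_funM => //.
  by apply: measurable_indic; exact: measurable_obox.
- by apply/measurable_EFinP; apply: measurable_funM;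
    [exact: measurableT_comp|exact: measurable_indic].
- move=> x _; rewrite -EFinM lee_fin normrM ler_wpM2l// !indicE normr_nat.
  have [xb|xb] := pselect (obox a b x).
    by rewrite !mem_set//; exact: obox_sub_cbox.
  by rewrite memNset.
Qed.

(** Dominated convergence along the plateau functions. *)
Lemma integral_box_eq0 h a b : L1loc h ->
  (forall g, test_function g -> \int[leb]_x (h x * g x) = 0) ->
  (\int[leb]_x (h x * \1_(obox a b) x)%:E = 0)%E.
Proof.
move=> Lh hg; have mh := Lh.1.
have Ih := L1loc_integrable_box a b Lh.
pose f k x : \bar R := (h x * plateau a b k x)%:E.
have mf k : measurable_fun setT (f k).
  apply/measurable_EFinP; apply: measurable_funM => //.
  apply: measurable_continuous_rV; apply: flat_algebra_continuous.
  exact: flat_algebra_plateau.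
have fle k x : (`|f k x| <= `|(h x * \1_(obox a b) x)%:E|)%E.
  rewrite lee_fin !normrM ler_wpM2l//.
  have /andP[p0 p1] := plateau_bounds a b k x.
  rewrite (ger0_norm p0) indicE normr_nat.
  have [xb|xb] := pselect (obox a b x); first by rewrite mem_set.
  by rewrite plateau_out// memNset.
have If k : leb.-integrable setT (f k) by apply: le_integrable Ih.
have f0 k : (\int[leb]_x f k x = 0)%E.
  have := hg _ (test_function_plateau a b k); rewrite /Rintegral => h0.
  by rewrite -[LHS]fineK ?integrable_fin_num// h0.
have mlim : measurable_fun setT (fun x => (h x * \1_(obox a b) x)%:E).
  by have /integrableP[] := Ih.
have fcvg : {ae leb, forall x, setT x ->
    f k x @[k --> \oo] --> (h x * \1_(obox a b) x)%:E}.
  apply: aeW => x _; apply: cvg_EFin; first exact: nearW.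
  by apply: cvgM; [exact: cvg_cst|exact: plateau_cvg].
have fdom : {ae leb, forall x, forall k, setT x ->
    (`|f k x| <= `|(h x * \1_(obox a b) x)%:E|)%E}.
  by apply: aeW => x k _; exact: fle.
have [_ _] := dominated_convergence measurableT mf mlim fcvg
  (integrable_abse Ih) fdom.
rewrite (_ : [sequence _]_k = cst 0%E); last first.
  by apply/funext => k; exact: f0.
move=> lim0; apply: (cvg_unique _ lim0); [exact: ereal_hausdorff|exact: cvg_cst].
Qed.

(** On a fixed cube Q the sets A for which h has zero integral over the
    intersection of A and Q form a Dynkin class containing the boxes. So h
    vanishes almost everywhere on Q, and countably many cubes cover the space.
    *)
Lemma L1loc_eq0 h : L1loc h ->
  (forall g, test_function g -> \int[leb]_x (h x * g x) = 0) ->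
  {ae leb, forall x, h x = 0}.
Proof.
move=> Lh hg.
pose Q (k : nat) := obox (const_mx (- k%:R)) (const_mx k%:R) : set 'rV[R]_n.
have Qae k : {ae leb, forall x, (h x * \1_(Q k) x)%:E = 0%E}.
  have iF : leb.-integrable setT (fun x => (h x * \1_(Q k) x)%:E).
    exact: L1loc_integrable_box.
  suff nu0 A : measurable A -> induced_charge iF A = 0%E.
    have := @integral_ae_eq _ _ _ leb setT measurableT (cst 0%E) _ iF.
    have h1 : measurable_fun [set: 'rV[R]_n] (cst (0%E : \bar R)) by [].
    move=> /(_ h1) H.
    have {}H := H _.
    have : ae_eq leb setT (fun x => (h x * \1_(Q k) x)%:E) (cst 0%E).
      by apply: H => E _ mE; rewrite integral0; exact: nu0.
    by apply: filterS => x; exact.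
  move=> mA; move: (mA); rewrite measurable_oboxes => sA.
  apply: (@dynkin_induction _ 'rV[R]_n oboxes (fun A => induced_charge iF A = 0%E)
    measurable_oboxes oboxes_setI_closed _ _ _ _ A sA).
  - exact: integral_box_eq0.
  - move=> _ [[a b] _ <-] /=; rewrite /induced_charge integral_indicE.
    have [[a' b'] _ /= E] : oboxes (Q k `&` obox a b).
      apply: oboxes_setI_closed; last by exists (a, b).
      by exists (const_mx (- k%:R), const_mx k%:R).
    rewrite -(integral_box_eq0 a' b' Lh hg) E; apply: eq_integral => x _.
    by rewrite -EFinM indicI /= mulrA.
  - move=> S mS S0.
    have := chargeD (induced_charge iF) measurableT mS; rewrite setTD setTI => ->.
    rewrite [X in (_ - X)%E]S0 sube0.
    exact: integral_box_eq0.
  - move=> F mF tF F0.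
    have := @charge_semi_sigma_additive _ _ _ (induced_charge iF) F mF tF
      (bigcupT_measurable _ mF).
    rewrite (_ : (fun k => _) = cst 0%E); last first.
      by apply/funext => j; apply: big1 => i _; exact: F0.
    move=> lim0; apply: (cvg_unique _ lim0); [exact: ereal_hausdorff|exact: cvg_cst].
have := ae_foralln Qae.
apply: filterS => x hx; have [k xk] := mem_centered_obox x.
by have := hx k; rewrite indicE mem_set// mulr1 => -[].
Qed.

End fundamental_lemma.

(** * The duality solution *)

Section test_functions.
Context {R : realType} {n : nat}.
Local Notation leb := (lebesgue_rV R n).
Implicit Types g h u v : 'rV[R]_n -> R.

Lemma continuous_enorm : continuous (@enorm R n).
Proof.
move=> x.
apply: (@continuous_comp _ _ _ (fun x : 'rV[R]_n => \sum_i x 0 i ^+ 2) Num.sqrt);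
  last exact: sqrt_continuous.
move: x; apply: continuous_big => [|i _ x].
  exact: add_continuous.
apply: (@continuous_comp _ _ _ (fun x : 'rV[R]_n => x 0 i) (fun r => r ^+ 2)).
  exact: coord_continuous.
exact: exprn_continuous.
Qed.

(** The Euclidean norm is continuous, hence bounded on K. *)
Lemma compact_sub_eball (K : set 'rV[R]_n) : compact K ->
  exists2 r : R, 0 < r & K `<=` [set x | enorm (x - 0) < r].
Proof.
move=> cK; have : compact (@enorm R n @` K).
  apply: continuous_compact => //; apply: continuous_subspaceT.
  exact: continuous_enorm.
move=> /compact_bounded[M [_ hM]].
exists (`|M| + 2); first by rewrite ltr_wpDl.
move=> x Kx; rewrite /= subr0.
have /hM/(_ _ (imageP (@enorm R n) Kx)) : M < `|M| + 1.
  by rewrite (le_lt_trans (ler_norm _))// ltrDl.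
move=> /(le_trans (ler_norm _)) /le_lt_trans; apply.
by rewrite ltrD2l ltrDl.
Qed.

Lemma test_function_continuous g : test_function g -> continuous g.
Proof. by move=> [sg _]; have [] := sg [::]. Qed.

Lemma test_function_support g : test_function g ->
  exists2 r : R, 0 < r & forall x, ~ enorm (x - 0) < r -> g x = 0.
Proof.
move=> [_ /compact_sub_eball[r r0 hr]]; exists r => // x xr.
by apply: contrapT => /eqP gx; apply: xr; apply: hr; exact: subset_closure.
Qed.

Lemma test_function_bounded g : test_function g ->
  exists B : R, forall x, `|g x| <= B.
Proof.
move=> tg; have cK := tg.2.
have : compact (g @` closure [set x | g x != 0]).
  apply: continuous_compact => //; apply: continuous_subspaceT.
  exact: test_function_continuous.
move=> /compact_bounded[M [_ hM]]; exists (`|M| + 1) => x.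
have [->|gx] := eqVneq (g x) 0; first by rewrite normr0 addr_ge0.
apply: hM; first by rewrite (le_lt_trans (ler_norm _))// ltrDl.
by exists x => //; exact: subset_closure.
Qed.

Lemma L1locB u v : L1loc u -> L1loc v -> L1loc (fun x => u x - v x).
Proof.
move=> [mu hu] [mv hv]; split; first exact: measurable_funB.
move=> K cK; have mK := compact_measurable_rV cK.
have mau : measurable_fun K (fun x => `|u x|%:E).
  apply: measurable_funTS; apply/measurable_EFinP; exact: measurableT_comp.
have mav : measurable_fun K (fun x => `|v x|%:E).
  apply: measurable_funTS; apply/measurable_EFinP; exact: measurableT_comp.
have a0 (f : 'rV[R]_n -> R) x : (0 <= `|f x|%:E)%E by rewrite lee_fin.
apply: (@le_lt_trans _ _ (\int[leb]_(x in K) (`|u x|%:E + `|v x|%:E))%E).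
  apply: (ge0_le_integral leb mK (fun x _ => a0 (fun x => u x - v x) x)).
  - apply: measurable_funTS; apply/measurable_EFinP; apply: measurableT_comp => //.
    exact: measurable_funB.
  - exact: emeasurable_funD.
  - by move=> x _; rewrite -EFinD lee_fin ler_normB.
rewrite (ge0_integralD leb mK (fun x _ => a0 u x) mau (fun x _ => a0 v x) mav).
exact: (lte_add_pinfty (hu _ cK) (hv _ cK)).
Qed.

Lemma L1loc_integrableM h g : L1loc h -> test_function g ->
  leb.-integrable setT (fun x => (h x * g x)%:E).
Proof.
move=> [mh hh] tg; have [B hB] := test_function_bounded tg.
have cK := tg.2; set K := closure _ in cK.
have mK := compact_measurable_rV cK.
have mg : measurable_fun setT g.
  by apply: measurable_continuous_rV; exact: test_function_continuous.
have mhg : measurable_fun setT (fun x => h x * g x) by exact: measurable_funM.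
have mah : measurable_fun K (fun x => `|h x|%:E).
  apply: measurable_funTS; apply/measurable_EFinP; exact: measurableT_comp.
have B0 : 0 <= B by exact: le_trans (normr_ge0 _) (hB 0).
apply/integrableP; split; first exact/measurable_EFinP.
apply: (@le_lt_trans _ _ (\int[leb]_(x in K) (B%:E * `|h x|%:E))%E); last first.
  rewrite (ge0_integralZl leb mK mah)//.
  by apply: lte_mul_pinfty; [rewrite lee_fin| |exact: hh].
rewrite [X in (_ <= X)%E]integral_indicE.
apply: (ge0_le_integral leb measurableT (fun x _ => abse_ge0 _)).
- apply: (measurableT_comp (f := abse)); first exact: abse_measurable.
  exact/measurable_EFinP.
- apply/measurable_EFinP; apply: measurable_funM; last exact: measurable_indic.
  by apply: measurable_funM => //; exact: measurableT_comp.
move=> x _; rewrite -!EFinM lee_fin normrM.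
have [->|gx] := eqVneq (g x) 0.
  by rewrite normr0 mulr0 !mulr_ge0.
rewrite indicE mem_set; last exact: subset_closure.
by rewrite mulr1 mulrC ler_wpM2r.
Qed.

End test_functions.

Section existence_uniqueness.
Context {R : realType} {n : nat}.
Local Notation leb := (lebesgue_rV R n).
Variable mu : {charge set 'rV[R]_n -> \bar R}.
Implicit Types (s C : R) (u v : 'rV[R]_n -> R).

Lemma duality_solution_unique s C u v :
  duality_solution s C mu u -> duality_solution s C mu v ->
  {ae leb, forall x, v x = u x}.
Proof.
move=> [Lu hu] [Lv hv].
have h0 : {ae leb, forall x, v x - u x = 0}.
  apply: L1loc_eq0 => [|g tg]; first exact: L1locB.
  under eq_Rintegral do rewrite mulrBl.
  rewrite RintegralB//; try exact: L1loc_integrableM.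
  by rewrite hu// hv// subrr.
by apply: filterS h0 => x /eqP; rewrite subr_eq0 => /eqP.
Qed.

Let posp := jordan_pos (projT2 (hahn_ex mu)).
Let negp := jordan_neg (projT2 (hahn_ex mu)).

Definition riesz_solution s C x : R :=
  C * (fine (potential posp (n%:R - 2 * s) x) -
       fine (potential negp (n%:R - 2 * s) x)).

(** The bound on q says that gap > 0, where gap is N - (a + eta) q. Moving
    from eta to theta = eta + eps / q uses up eps of this gap; eps <= 2 - 2s
    ensures theta <= 1. *)
Lemma frac_sobolev_riesz_solution s C q (O : set 'rV[R]_n) :
  1 / 2 < s < 1 -> 2 * s < n%:R -> 1 <= q ->
  q < (n%:R + 2 - 2 * s) / (n%:R + 1 - 2 * s) ->
  measurable O -> (leb O < +oo)%E ->
  frac_sobolev (1 - (2 - 2 * s) / q) q O (riesz_solution s C).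
Proof.
move=> /andP[s0 s1] sn q1 q2 mO Ooo.
have q0 : 0 < q by exact: lt_le_trans q1.
have gap0 : 0 < n%:R + 2 - 2 * s - (n%:R + 1 - 2 * s) * q.
  by rewrite subr_gt0 mulrC -ltr_pdivlMr//; lra.
set gap := (X in 0 < X) in gap0.
pose eps := Num.min (2 - 2 * s) (gap / 2).
have eps0 : 0 < eps by rewrite lt_min divr_gt0//= andbT; lra.
have eps1 : eps <= 2 - 2 * s by rewrite ge_min lexx.
have eps2 : eps <= gap / 2 by rewrite ge_min lexx orbT.
pose eta := 1 - (2 - 2 * s) / q; pose theta := eta + eps / q.
have etaq : eta * q = q - (2 - 2 * s) by rewrite mulrBl divfK ?gt_eqF// mul1r.
have thetaq : theta * q = q - (2 - 2 * s) + eps.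
  by rewrite mulrDl divfK ?gt_eqF// etaq.
have eth : eta < theta by rewrite ltrDl divr_gt0.
have th0 : 0 < theta.
  by rewrite -(pmulr_lgt0 _ q0) thetaq; lra.
have th1 : theta <= 1.
  by rewrite -(ler_pM2r q0) thetaq mul1r; lra.
have P nu : frac_sobolev eta q O
    (fun x => fine (@potential R n nu (n%:R - 2 * s) x)).
  apply: (@frac_sobolev_potential _ _ _ _ theta) => //.
  - by rewrite subr_gt0.
  - by rewrite th0.
  - by rewrite -addrA -mulrBl mulrBl etaq thetaq; lra.
  - by rewrite mulrDl thetaq; move: eps2 gap0; rewrite /gap; lra.
exact: (frac_sobolev_scaled_sub C q0 mO (measurable_fine_potential posp _)
  (measurable_fine_potential negp _) (P posp) (P negp)).
Qed.

(** The case q = 1 of the fractional Sobolev regularity contains local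
    integrability. *)
Lemma riesz_solution_L1loc s C : 1 / 2 < s < 1 -> 2 * s < n%:R ->
  L1loc (riesz_solution s C).
Proof.
move=> s01 sn; split.
  apply: measurable_funM => //.
  by apply: measurable_funB; exact: measurable_fine_potential.
move=> K cK; have [r r0 Kr] := compact_sub_eball cK.
have [|mu1 I1 _] := @frac_sobolev_riesz_solution s C 1 _ s01 sn (lexx 1) _
   (measurable_eball 0 r) (lebesgue_eball_lty 0 r).
  by have /andP[s0 s1] := s01; rewrite ltr_pdivlMr; lra.
apply: le_lt_trans I1.
rewrite (eq_integral (fun x => (`|riesz_solution s C x| `^ 1)%:E)); last first.
  by move=> x _; rewrite powRr1.
apply: (ge0_subset_integral leb (compact_measurable_rV cK) (measurable_eball 0 r)).
- apply/measurable_EFinP; apply: (measurableT_comp (measurable_powR 1)).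
  exact: measurableT_comp.
- by move=> x _; rewrite lee_fin powR_ge0.
- exact: Kr.
Qed.

Lemma riesz_solution_duality s C : 1 / 2 < s < 1 -> 2 * s < n%:R ->
  duality_solution s C mu (riesz_solution s C).
Proof.
move=> s01 sn; split; first exact: riesz_solution_L1loc.
move=> g tg; have /andP[s0 s1] := s01.
have an : 0 < n%:R - 2 * s < n%:R by lra.
set a := n%:R - 2 * s in an.
have [r r0 gr] := test_function_support tg.
have [B gB] := test_function_bounded tg.
have mg : measurable_fun setT g.
  by apply: measurable_continuous_rV; exact: test_function_continuous.
have mO := measurable_eball (0 : 'rV[R]_n) r.
have Ooo := lebesgue_eball_lty (0 : 'rV[R]_n) r.
have Iu nu := @integrable_potentialM R n nu a B _ g an mO Ooo mg gB gr.
have Iw nu := @integrable_riesz_transform R n nu a B _ g an mO Ooo mg gB gr.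
have D nu := @potential_duality R n nu a B _ g an mO Ooo mg gB gr.
have wE : riesz_potential s C g = fun y =>
    C * \int[leb]_x (g x * riesz_kernel a x y).
  apply/funext => y; congr (C * _); apply: eq_Rintegral => x _.
  by rewrite /riesz_kernel powRN enorm_distC.
have E (nu : {finite_measure set 'rV[R]_n -> \bar R}) :
    \int[nu]_y riesz_potential s C g y =
    C * \int[leb]_x (fine (potential nu a x) * g x).
  by rewrite wE (D nu); exact: (RintegralZl C measurableT (Iw nu)).
rewrite /charge_integral [X in X - _](E posp) [X in _ - X](E negp).
rewrite -mulrBr -RintegralB//; try exact: Iu.
rewrite -RintegralZl//; last first.
  have := integrableB measurableT (Iu posp) (Iu negp).
  by apply: eq_integrable => // x _; rewrite /= EFinB.
by apply: eq_Rintegral => x _; rewrite /riesz_solution -/a -mulrBl mulrA.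
Qed.

End existence_uniqueness.

Theorem theorem1p1 (R : realType) (N : nat) (hN : (2 <= N)%N) (s : R)
    (hs : 1 / 2 < s < 1) (c C : R) (hc : 0 < c) (hC : riesz_constant N s c C)
    (mu : {charge set 'rV[R]_N -> \bar R}) (hmu : compactly_supported mu) :
  exists u : 'rV[R]_N -> R,
    [/\ duality_solution s C mu u,
        forall v, duality_solution s C mu v ->
          {ae lebesgue_rV R N, forall x, v x = u x} &
        forall q : R, 1 <= q -> q < (N%:R + 2 - 2 * s) / (N%:R + 1 - 2 * s) ->
          frac_sobolev_loc (1 - (2 - 2 * s) / q) q u].
Proof.
have sN : 2 * s < N%:R.
  have : 2 <= N%:R :> R by rewrite ler_nat.
  by have /andP[_ s1] := hs; lra.
have du := riesz_solution_duality mu C hs sN.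
exists (riesz_solution mu s C); split => //.
  by move=> v dv; exact: duality_solution_unique du dv.
move=> q q1 q2 x0 r r0; apply: frac_sobolev_riesz_solution => //.
  exact: measurable_eball.
exact: lebesgue_eball_lty.
Qed.
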